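(* For every $i\in\mathbb N$ there exists a unique numerical solution $v_i:S_i\to V_i^g$, i.e. a unique $v_i$ with $v_i(T,\cdot)=P_iv_T$ and, for all $k\in\{T/h_i-1,\dots,0\}$, $$-d_iv_i(s_i^k,\cdot)+\inf_{\beta\in B}\sup_{\alpha\in A}\bigl(\mathsf E_i^{(\alpha,\beta)}v_i(s_i^{k+1},\cdot)+\mathsf I_i^{(\alpha,\beta)}v_i(s_i^k,\cdot)-\mathsf F_i^{(\alpha,\beta)}\bigr)=0.$$
   Context: **Data.** Let $d\ge 2$, $\Omega\subset\mathbb R^d$ a bounded Lipschitz domain, $T>0$, and $A,B$ compact metric spaces. Let $v_T\in C(\overline\Omega)$, $g\in\{w\in W^{1,\infty}(\mathbb R^d):\Delta w\in L^\infty(\Omega)\}$, $v_T=g$ on $\partial\Omega$. **Finite elements.** For $i\in\mathbb N$ let $V_i$ be the space of continuous piecewise linear functions on a simplicial mesh of $\Omega$ (meshes shape-regular uniformly in $i$) with nodes $y_i^\ell$ and hat functions $\phi_i^\ell$; $\hat\phi_i^\ell=\phi_i^\ell/\|\phi_i^\ell\|_{L^1(\Omega)}$. $V_i^0\subset V_i$ is the subspace vanishing on $\partial\Omega$, $N_i=\dim V_i^0$, and nodes are ordered so that $y_i^\ell\in\Omega$ iff $\ell\le N_i$. The time step $h_i>0$ satisfies $T/h_i\in\mathbb N$; $s_i^k=kh_i$, $S_i=\{s_i^k:k=0,\dots,T/h_i\}$. Functions in $V_i$ are identified with their vectors of nodal values. $\langle\cdot,\cdot\rangle$ is the $L^2(\Omega)$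 inner product. $P_ig,P_iv_T\in V_i$ are the images of $g,v_T$ under a linear map $P_i$ into $V_i$ (an elliptic projection), with $P_iv_T=P_ig$ on $\partial\Omega$. $V_i^g\subset V_i$ is the set of functions equal to $P_ig$ on $\partial\Omega$. **Splitting.** Coefficients $\bar a_i^{(\alpha,\beta)},\bar{\bar a}_i^{(\alpha,\beta)}\in C(\overline\Omega)$, $\bar b_i^{(\alpha,\beta)},\bar{\bar b}_i^{(\alpha,\beta)}\in L^\infty(\Omega,\mathbb R^d)$, $\bar c_i^{(\alpha,\beta)},\bar{\bar c}_i^{(\alpha,\beta)},f_i^{(\alpha,\beta)}\in L^\infty(\Omega)$ depend continuously (in $L^\infty$) on $(\alpha,\beta)\in A\times B$ for each $i$. Also $\bar c_i^{(\alpha,\beta)},\bar{\bar c}_i^{(\alpha,\beta)}\ge0$ and $\|\bar c_i^{(\alpha,\beta)}\|_{L^\infty}+\|\bar{\bar c}_i^{(\alpha,\beta)}\|_{L^\infty}\le\gamma$ for a constant $\gamma$. **Discrete operators.** For $\ell\le N_i$: $(\mathsf E_i^{(\alpha,\beta)}w)_\ell=\bar a_i^{(\alpha,\beta)}(y_i^\ell)\langle\nabla w,\nabla\hat\phi_i^\ell\rangle+\langle-\bar b_i^{(\alpha,\beta)}\cdot\nabla w+\bar c_i^{(\alpha,\beta)}w,\hat\phi_i^\ell\rangle$, $(\mathsf I_i^{(\alpha,\beta)}w)_\ell=\bar{\bar a}_i^{(\alpha,\beta)}(y_i^\ell)\langle\nabla w,\nabla\hat\phi_i^\ell\rangle+\langle-\bar{\bar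 b}_i^{(\alpha,\beta)}\cdot\nabla w+\bar{\bar c}_i^{(\alpha,\beta)}w,\hat\phi_i^\ell\rangle$, $(\mathsf F_i^{(\alpha,\beta)})_\ell=\langle f_i^{(\alpha,\beta)},\hat\phi_i^\ell\rangle$. For $\ell>N_i$: $(\mathsf E_i^{(\alpha,\beta)}w)_\ell=0$, $(\mathsf I_i^{(\alpha,\beta)}w)_\ell=w(y_i^\ell)$, $(\mathsf F_i^{(\alpha,\beta)})_\ell=(P_ig)(y_i^\ell)$. Infimum and supremum of vectors are componentwise, and $(d_iw(s_i^k,\cdot))_\ell=(w(s_i^{k+1},y_i^\ell)-w(s_i^k,y_i^\ell))/h_i$. **Monotonicity assumption.** For all $(\alpha,\beta)$ and $i$: $\mathsf E_i^{(\alpha,\beta)}$ restricted to $V_i$ (matrix in the nodal basis) has non-positive off-diagonal entries; $h_i$ is so small that all entries of $h_i\mathsf E_i^{(\alpha,\beta)}-\mathsf{Id}$ are non-positive; and $\mathsf I_i^{(\alpha,\beta)}$ has the local monotonicity property: if $v\in V_i$ has a non-positive local minimum at an interior node $y_i^\ell$ then $(\mathsf I_i^{(\alpha,\beta)}v)_\ell\le0$. *)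

(* Defs.v *)
From HB Require Import structures.
From mathcomp Require Import all_boot all_order all_algebra.
From mathcomp Require Import all_classical all_reals all_analysis.

Set Implicit Arguments.
Unset Strict Implicit.
Unset Printing Implicit Defensive.

Import Order.TTheory GRing.Theory Num.Theory.
Import numFieldNormedType.Exports.

Local Open Scope classical_set_scope.
Local Open Scope ring_scope.

Definition rV_display : measure_display -> measure_display.
Proof. exact. Qed.

Section measurable_rV.
Context {R : realType} (n : nat).

Definition rV_coord (i : 'I_n) : 'rV[R]_n -> R := fun x => x 0 i.

Let rV_set0 : g_sigma_preimage rV_coord set0.
Proof. exact: sigma_algebra0. Qed.

Let rV_setC A : g_sigma_preimage rV_coord A -> g_sigma_preimage rV_coord (~` A).
Proof. exact: sigma_algebraC. Qed.

Let rV_bigcup (F : _^nat) : (forall i, g_sigma_preimage rV_coord (F i)) ->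
  g_sigma_preimage rV_coord (\bigcup_i (F i)).
Proof. exact: sigma_algebra_bigcup. Qed.

(* The product sigma-algebra on R^n, which is its Borel sigma-algebra. *)
HB.instance Definition _ := @isMeasurable.Build
  (rV_display R.-ocitv) 'rV[R]_n
  (g_sigma_preimage rV_coord) rV_set0 rV_setC rV_bigcup.

End measurable_rV.

Section sigma_finite_measure_of.
Context d (T : measurableType d) (R : realType).
Variables (m : {measure set T -> \bar R}) (m_sfin : sigma_finite setT m).

(* [m] itself; the dummy [let] makes the proof [m_sfin] an argument, so that the
   sigma-finite structure can be attached. *)
Definition sigma_finite_measure_of : set T -> \bar R := let _ := m_sfin in m.

HB.instance Definition _ := Measure.on sigma_finite_measure_of.
HB.instance Definition _ :=
  Measure_isSigmaFinite.Build _ _ _ sigma_finite_measure_of m_sfin.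

End sigma_finite_measure_of.

Section lebesgue_rV.
Context {R : realType}.
Local Open Scope ereal_scope.

Definition rV_cons n (p : measurableTypeR R * 'rV[R]_n) : 'rV[R]_(n.+1) :=
  row_mx (const_mx p.1 : 'rV[R]_1) p.2.

Lemma measurable_rV_coord n (i : 'I_n) :
  measurable_fun [set: 'rV[R]_n] (@rV_coord R n i).
Proof.
move=> _ Y mY; rewrite setTI; apply: sub_sigma_algebra => /=.
rewrite -bigcup_seq/=; exists i => /=; first by rewrite mem_index_enum.
by exists Y => //; rewrite setTI.
Qed.

Lemma measurable_rV_cons n : measurable_fun setT (@rV_cons n).
Proof.
move=> _; apply: (@measurability _ _ _ _ _ _ 
  (\big[setU/set0]_(i < n.+1) preimage_set_system setT (@rV_coord R n.+1 i) measurable)) => //.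
move=> _ [B + <-]; rewrite -bigcup_seq => -[i _ [Y mY <-]].
rewrite !setTI -comp_preimage.
suff mi : measurable_fun setT (@rV_coord R n.+1 i \o @rV_cons n).
  by rewrite -[X in measurable X]setTI; exact: mi.
rewrite (_ : _ \o _ = fun p : measurableTypeR R * 'rV[R]_n => match fintype.split (i : 'I_(1 + n)) with
  | inl _ => p.1 | inr k => rV_coord k p.2 end); last first.
  by apply/funext => p /=; rewrite /rV_coord /rV_cons mxE; case: (fintype.split _) => // k; rewrite mxE.
case: (fintype.split _) => k; first exact: measurable_fst.
apply: (measurableT_comp (measurable_rV_coord k)).
exact: measurable_snd.
Qed.


Fixpoint lebesgue_rV n : set 'rV[R]_n -> \bar R :=
  match n with
  | 0 => @dirac _ 'rV[R]_0 0%R R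
  | m.+1 => pushforward (lebesgue_measure \x @lebesgue_rV m)%E (@rV_cons m)
  end.

Lemma lebesgue_rV_sigma_finite_measure n :
  exists mu : {sigma_finite_measure set 'rV[R]_n -> \bar R},
    lebesgue_rV (n := n) = mu.
Proof.
elim: n => [|n [mu IH]]; first by exists (@dirac _ 'rV[R]_0 0%R R).
pose m12 : {measure set (measurableTypeR R * 'rV[R]_n)%type -> \bar R} :=
  (lebesgue_measure \x mu)%E.
pose psi : {measure set 'rV[R]_(n.+1) -> \bar R} :=
  measure_function_pushforward__canonical__measure_function_Measure m12
    (@measurable_rV_cons n).
have psi_sfin : sigma_finite setT psi.
  have /sigma_finiteP[F [FT ndF Foo]] :=
    sigma_finiteT (@lebesgue_measure R : {sigma_finite_measure set _ -> \bar R}).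
  have /sigma_finiteP[G [GT ndG Goo]] := sigma_finiteT mu.
  pose g (v : 'rV[R]_(n.+1)) : measurableTypeR R * 'rV[R]_n :=
    (rV_coord ord0 v, \row_(i < n) rV_coord (lift ord0 i) v).
  have gK : cancel (@rV_cons n) g.
    move=> [x v]; rewrite /g /rV_coord /rV_cons; congr pair.
      by rewrite mxE; case: fintype.splitP => // j; rewrite mxE.
    apply/rowP => i; rewrite !mxE; case: fintype.splitP => j /=; first by rewrite [j]ord1.
    by rewrite /bump /= => -[ij]; congr (v _ _); exact/val_inj.
  have mg : measurable_fun setT g.
    apply/measurable_fun_pairP; split; first exact: measurable_rV_coord.
    move=> _; apply: (@measurability _ _ _ _ _ _
      (\big[setU/set0]_(i < n)
         preimage_set_system setT (@rV_coord R n i) measurable)) => //.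
    move=> _ [B + <-]; rewrite -bigcup_seq => -[i _ [Y mY <-]].
    rewrite !setTI -comp_preimage.
    rewrite (_ : _ \o _ = @rV_coord R n.+1 (lift ord0 i)); last first.
      by apply/funext => v; rewrite /rV_coord /= mxE.
    by rewrite -[X in measurable X]setTI; exact: measurable_rV_coord.
  exists (fun k => g @^-1` (F k `*` G k)).
    apply/esym; rewrite -subTset => v _.
    have : setT (g v).1 by []. rewrite FT => -[i _ Fi].
    have : setT (g v).2 by []. rewrite GT => -[j _ Gj].
    exists (maxn i j) => //=; split.
    - by move: Fi; exact/subsetPset/ndF/leq_maxl.
    - by move: Gj; exact/subsetPset/ndG/leq_maxr.
  move=> k; have [mF Fk] := Foo k; have [mG Gk] := Goo k; split.
    by rewrite -[X in measurable X]setTI; apply: mg => //; exact: measurableX.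
  rewrite /psi /= /pushforward -comp_preimage.
  rewrite (_ : g \o _ = id); last by apply/funext => p; exact: gK.
  by rewrite /m12 /= product_measure1E// lte_mul_pinfty// ge0_fin_numE.
by exists (sigma_finite_measure_of psi_sfin); rewrite /= IH.
Qed.

Let lebesgue_rV0 n : lebesgue_rV (n := n) set0 = 0.
Proof. by have [mu ->] := lebesgue_rV_sigma_finite_measure n; exact: measure0. Qed.

Let lebesgue_rV_ge0 n A : 0 <= lebesgue_rV (n := n) A.
Proof. by have [mu ->] := lebesgue_rV_sigma_finite_measure n; exact: measure_ge0. Qed.

Let lebesgue_rV_sigma_additive n : semi_sigma_additive (@lebesgue_rV n).
Proof.
have [mu ->] := lebesgue_rV_sigma_finite_measure n.
exact: measure_semi_sigma_additive.
Qed.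

HB.instance Definition _ n := isMeasure.Build _ _ _ (@lebesgue_rV n)
  (lebesgue_rV0 n) (@lebesgue_rV_ge0 n) (@lebesgue_rV_sigma_additive n).

Let lebesgue_rV_sigma_finite n : sigma_finite setT (@lebesgue_rV n).
Proof.
by have [mu ->] := lebesgue_rV_sigma_finite_measure n; exact: sigma_finiteT.
Qed.

HB.instance Definition _ n := Measure_isSigmaFinite.Build _ _ _ (@lebesgue_rV n)
  (@lebesgue_rV_sigma_finite n).

End lebesgue_rV.
Arguments lebesgue_rV {R n}.

Lemma lebesgue_rV_box (R : realType) n (A : 'I_n -> set (measurableTypeR R)) :
  (forall i, measurable (A i)) ->
  lebesgue_rV [set x : 'rV[R]_n | forall i, A i (x 0 i)] =
  (\prod_(i < n) lebesgue_measure (A i))%E.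
Proof.
elim: n A => [|n IH] A mA.
  rewrite big_ord0 /= diracE mem_set // => -[] //.
rewrite big_ord_recl -IH => [|i]; last exact: mA.
have [mu muE] := @lebesgue_rV_sigma_finite_measure R n.
rewrite [LHS]/= /pushforward muE.
set B := [set x : 'rV[R]_n | _].
have mB : measurable B.
  have -> : B = \bigcap_(i in [set: 'I_n]) (@rV_coord R n i @^-1` A (lift ord0 i)).
    by apply/seteqP; split => x /= h i => [_|]; apply: h.
  apply: fin_bigcap_measurable => [|i _]; first exact: finite_finset.
  have := @measurable_rV_coord R n i measurableT _ (mA (lift ord0 i)).
  by rewrite setTI.
rewrite -product_measure1E //; congr (_ _).
apply/seteqP; split => -[x v]; rewrite /rV_cons /=.
  move=> h; split => [|i] /=.
    have := h ord0; rewrite mxE; case: fintype.splitP => j; last by [].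
    by rewrite mxE.
  have := h (lift ord0 i); rewrite mxE; case: fintype.splitP => j /=.
    by rewrite [j]ord1.
  by rewrite /bump /= add1n add1n => -[/val_inj ->].
move=> [/= Ax Bv] i; rewrite mxE; case: fintype.splitP => j ij.
  rewrite mxE (_ : i = ord0) //; apply: val_inj => /=.
  by rewrite ij [j]ord1.
by rewrite (_ : i = lift ord0 j) //; apply: val_inj.
Qed.

Section euclidean.
Context {R : realType} {n : nat}.
Implicit Types (x y u v : 'rV[R]_n) (U Omega : set 'rV[R]_n).

Definition dotv u v : R := \sum_(j < n) u 0 j * v 0 j.

Definition enorm u : R := Num.sqrt (dotv u u).

Definition bdry Omega : set 'rV[R]_n := closure Omega `\` interior Omega.

(* [nu] is the inner "vertical" direction of the local coordinates at the
   boundary point [x0] and [u - dotv u nu *: nu] the horizontal component. *)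
Definition lipschitz_graph_at Omega x0 : Prop :=
  exists (nu : 'rV[R]_n) (r L : R) (psi : 'rV[R]_n -> R),
    [/\ enorm nu = 1, 0 < r,
        forall u v, `|psi u - psi v| <= L * enorm (u - v) &
        forall x, enorm (x - x0) < r ->
          (Omega x <-> psi (x - dotv x nu *: nu) < dotv x nu)].

Definition bounded_lipschitz_domain Omega : Prop :=
  [/\ open Omega, Omega !=set0, connected Omega, bounded_set Omega &
      forall x0, bdry Omega x0 -> lipschitz_graph_at Omega x0].

Definition partial (j : 'I_n) (f : 'rV[R]_n -> R) : 'rV[R]_n -> R :=
  fun x => 'D_(delta_mx 0 j) f x.

Definition grad (f : 'rV[R]_n -> R) : 'rV[R]_n -> 'rV[R]_n :=
  fun x => \row_j partial j f x.

Definition laplacian (f : 'rV[R]_n -> R) : 'rV[R]_n -> R :=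
  fun x => \sum_(j < n) partial j (partial j f) x.

Definition smooth (f : 'rV[R]_n -> R) : Prop :=
  forall s : seq 'I_n, let fs := foldr partial f s in
    continuous fs /\ forall x j, derivable fs x (delta_mx 0 j).

Definition test_function U (f : 'rV[R]_n -> R) : Prop :=
  smooth f /\ exists K : set 'rV[R]_n,
    [/\ compact K, K `<=` U & forall x, ~ K x -> f x = 0].

Definition Linf_norm U (f : 'rV[R]_n -> R) : \bar R :=
  'N[lebesgue_rV]_+oo[EFin \o (f \_ U)].

Definition Linf U (f : 'rV[R]_n -> R) : Prop :=
  measurable_fun U f /\ (Linf_norm U f < +oo)%E.

Definition Linf_vec U (b : 'rV[R]_n -> 'rV[R]_n) : Prop :=
  (forall j, measurable_fun U (fun x => b x 0 j)) /\
  (Linf_norm U (enorm \o b) < +oo)%E.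

Definition weak_partial U (j : 'I_n) (f fj : 'rV[R]_n -> R) : Prop :=
  forall t, test_function U t ->
    \int[lebesgue_rV]_(x in U) (f x * partial j t x) =
    - \int[lebesgue_rV]_(x in U) (fj x * t x).

Definition weak_laplacian U (f lf : 'rV[R]_n -> R) : Prop :=
  forall t, test_function U t ->
    \int[lebesgue_rV]_(x in U) (f x * laplacian t x) =
    \int[lebesgue_rV]_(x in U) (lf x * t x).

(* Elements of W^{1,oo}(R^n) are represented by their continuous versions, so
   that their values on null sets such as boundaries are meaningful. *)
Definition W1inf (f : 'rV[R]_n -> R) : Prop :=
  [/\ continuous f, Linf setT f &
      forall j, exists2 fj, Linf setT fj & weak_partial setT j f fj].

Definition inner U (f f' : 'rV[R]_n -> R) : R :=
  \int[lebesgue_rV]_(x in U) (f x * f' x).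

Definition inner_vec U (F G : 'rV[R]_n -> 'rV[R]_n) : R :=
  \int[lebesgue_rV]_(x in U) dotv (F x) (G x).

End euclidean.

Record mesh (R : realType) (n : nat) := Mesh {
  nb_nodes : nat;
  node : 'I_nb_nodes -> 'rV[R]_n;
  cells : {set {set 'I_nb_nodes}} }.

Section finite_elements.
Context {R : realType} {n : nat}.
Variables (Omega : set 'rV[R]_n) (M : mesh R n).
Notation fct := ('rV[R]_n -> R).

Definition hull (K : {set 'I_(nb_nodes M)}) : set 'rV[R]_n :=
  [set x | exists lam : 'I_(nb_nodes M) -> R,
    [/\ forall m, 0 <= lam m, forall m, m \notin K -> lam m = 0,
        \sum_m lam m = 1 & x = \sum_m lam m *: node m]].

Definition affinely_independent (K : {set 'I_(nb_nodes M)}) : Prop :=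
  forall lam : 'I_(nb_nodes M) -> R,
    (forall m, m \notin K -> lam m = 0) -> \sum_m lam m = 0 ->
    \sum_m lam m *: node m = 0 -> forall m, lam m = 0.

Definition simplicial_mesh : Prop :=
  [/\ injective (@node R n M),
      forall l, exists2 K, K \in cells M & l \in K,
      forall K, K \in cells M -> #|K| = n.+1 /\ affinely_independent K,
      forall K K', K \in cells M -> K' \in cells M ->
        hull K `&` hull K' = hull (K :&: K') &
      \bigcup_(K in [set K | K \in cells M]) hull K = closure Omega].

(* diameter at most sigma times the radius of an inscribed ball *)
Definition shape_regular (sigma : R) : Prop :=
  forall K, K \in cells M -> exists (x0 : 'rV[R]_n) (r : R),
    [/\ 0 < r, forall x, enorm (x - x0) <= r -> hull K x &
        forall x y, hull K x -> hull K y -> enorm (x - y) <= sigma * r].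

(* Functions on the closure of Omega are extended by 0, so that the elements
   of the finite element space are equal as soon as they agree there. *)
Definition fe_space : set fct :=
  [set w | [/\ forall x, ~ closure Omega x -> w x = 0,
     {within closure Omega, continuous w} &
     forall K, K \in cells M -> exists (p : 'rV[R]_n) (c : R),
       forall x, hull K x -> w x = dotv p x + c]].

Definition fe_space_trace (u : fct) : set fct :=
  [set w | fe_space w /\ forall x, bdry Omega x -> w x = u x].

Definition fe_space0 : set fct := fe_space_trace (fun=> 0).

Definition has_dim (W : set fct) (N : nat) : Prop :=
  exists2 e : 'I_N -> fct, (forall k, W (e k)) &
    forall w, W w -> exists! c : 'rV[R]_N, w = fun x => \sum_k c 0 k * e k x.

Definition hat_functions (phi : 'I_(nb_nodes M) -> fct) : Prop :=
  forall l, fe_space (phi l) /\ forall m, phi l (node m) = (l == m)%:R.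

(* The piecewise constant representative of the weak gradient: the pointwise
   gradient inside the cells, and 0 on the null set of the cell boundaries. *)
Definition fe_grad (w : fct) : 'rV[R]_n -> 'rV[R]_n := fun x =>
  if `[< exists2 K, K \in cells M & interior (hull K) x >] then grad w x else 0.

End finite_elements.

Record coefficients (R : realType) (n : nat) := Coefficients {
  diffusion : 'rV[R]_n -> R;
  advection : 'rV[R]_n -> 'rV[R]_n;
  reaction : 'rV[R]_n -> R }.

Section coefficient_families.
Context {R : realType} {n : nat} {P : topologicalType}.
Variable Omega : set 'rV[R]_n.

Definition Linf_continuous (F : P -> 'rV[R]_n -> R) : Prop :=
  forall p, Linf_norm Omega (F q \- F p) @[q --> p] --> 0%E.

Definition Linf_vec_continuous (F : P -> 'rV[R]_n -> 'rV[R]_n) : Prop :=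
  forall p, Linf_norm Omega (fun x => enorm (F q x - F p x)) @[q --> p] --> 0%E.

Definition coefficient_family (C : P -> coefficients R n) : Prop :=
  [/\ forall p, [/\ {within closure Omega, continuous (diffusion (C p))},
        Linf_vec Omega (advection (C p)), Linf Omega (reaction (C p)) &
        {ae lebesgue_rV, forall x, Omega x -> 0 <= reaction (C p) x}],
      Linf_continuous (fun p => diffusion (C p)),
      Linf_vec_continuous (fun p => advection (C p)) &
      Linf_continuous (fun p => reaction (C p))].

End coefficient_families.

Section discrete_operators.
Context {R : realType} {n : nat}.
Variables (Omega : set 'rV[R]_n) (M : mesh R n).
Variable phi : 'I_(nb_nodes M) -> 'rV[R]_n -> R.
Variable N : nat.
Notation fct := ('rV[R]_n -> R).

Definition hat1 (l : 'I_(nb_nodes M)) : fct := fun x =>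
  phi l x / \int[lebesgue_rV]_(y in Omega) `|phi l y|.

Definition interior_row (C : coefficients R n) (w : fct)
    (l : 'I_(nb_nodes M)) : R :=
  diffusion C (node l) *
    inner_vec Omega (fe_grad M w) (fe_grad M (hat1 l)) +
  inner Omega (fun x => - dotv (advection C x) (fe_grad M w x) +
                        reaction C x * w x) (hat1 l).

Definition explicit_op (C : coefficients R n) (w : fct)
    (l : 'I_(nb_nodes M)) : R :=
  if (l < N)%N then interior_row C w l else 0.

Definition implicit_op (C : coefficients R n) (w : fct)
    (l : 'I_(nb_nodes M)) : R :=
  if (l < N)%N then interior_row C w l else w (node l).

(* [Pg] is the discrete boundary datum. *)
Definition source (f Pg : fct) (l : 'I_(nb_nodes M)) : R :=
  if (l < N)%N then inner Omega f (hat1 l) else Pg (node l).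

Definition local_monotonicity (L : fct -> 'I_(nb_nodes M) -> R) : Prop :=
  forall (v : fct) l, fe_space Omega M v -> Omega (node l) ->
    v (node l) <= 0 -> (\forall x \near node l, v (node l) <= v x) ->
    L v l <= 0.

(* Time is indexed by k, standing for the time k * h. *)
Definition numerical_solution (A B : Type) (CE CI : A * B -> coefficients R n)
    (f : A * B -> fct) (Pg PvT : fct) (h : R) (K : nat)
    (v : 'I_K.+1 -> fct) : Prop :=
  [/\ forall k, fe_space_trace Omega M Pg (v k), v ord_max = PvT &
      forall (k : 'I_K) (l : 'I_(nb_nodes M)),
        let vk := v (widen_ord (leqnSn K) k) in
        let vk1 := v (lift ord0 k) in
        - ((vk1 (node l) - vk (node l)) / h) +
        inf [set sup [set explicit_op (CE (alpha, beta)) vk1 l +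
                          implicit_op (CI (alpha, beta)) vk l -
                          source (f (alpha, beta)) Pg l
                     | alpha in [set: A]] | beta in [set: B]] = 0].

End discrete_operators.

(* Main.v *)
From HB Require Import structures.
Require Import Defs.
From mathcomp Require Import all_boot all_order all_algebra.
From mathcomp Require Import all_classical all_reals all_analysis.
From mathcomp Require Import measurable_realfun ess_sup_inf.
From mathcomp Require Import ring lra.

Set Implicit Arguments.
Unset Strict Implicit.
Unset Printing Implicit Defensive.

Import Order.TTheory GRing.Theory Num.Theory.
Import numFieldNormedType.Exports.

Local Open Scope classical_set_scope.
Local Open Scope ring_scope.

(** At each time level the scheme is a finite system for the nodal values of the
    unknown [w]: with [u] the already known next time level,
    [(w_l - u_l) / h + inf_beta sup_alpha (q_l + sum_m a_lm w_m) = 0],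
    where the matrix [a] consists of the values of the implicit operator on the
    hat functions and depends on the control pair, as does [q].

    The local monotonicity property, applied to the hat function of another
    node and to minus the sum of all hat functions, says that [a] has
    non-positive off-diagonal entries and non-negative row sums
    ([implicit_op_offdiag], [implicit_op_rowsum]).  If [L] bounds all the
    entries, then increasing the nodal values by at most [d] decreases row [l]
    by at most [L] times the gap between [d] and the increase at node [l]
    ([row_decrement]).  This estimate survives [inf sup], and it makes the
    damped fixed-point iteration with parameter [1 / (1 + h L)] a contraction of
    the maximum norm ([step_contraction]); the Banach fixed-point theorem solves
    the system uniquely, and induction over the time levels gives the theorem.

    Three facts turn the scheme into this system.
    - The rows are linear in the finite element function ([interior_row_lin]).
      All integrands are products of essentially bounded functions over a
      bounded open set, hence integrable; discrete gradients are locally constant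
      inside the cells, hence measurable.
    - The entries are bounded uniformly in the controls
      ([family_interior_row_bounded]), without which [inf] and [sup] would not be
      meaningful.  This comes from the continuity of the coefficients with
      respect to the uniform norm and from the compactness of the control sets;
      the diffusion, which is evaluated at nodes, is controlled there because it
      is continuous and balls have positive measure.
    - A solution of the system has the right values on the whole boundary and
      not only at the boundary nodes, because the hat functions of the interior
      nodes vanish on the boundary ([hat_bdry]).  If such a hat function were
      positive at [x], a dilation centered at its node would carry [x] into the
      domain, and scaling back the cells met there would cover a neighbourhood of
      [x]; but a Lipschitz domain contains the interior of its closure. *)

(** * Fixed points for systems of inf-sup type *)

Section row_vector_norm.
Context {R : realType} {n : nat}.
Implicit Types (v : 'rV[R]_n) (c : R).

Lemma coord_le_norm v j : `|v 0 j| <= `|v|.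
Proof.
rewrite [leRHS]mx_normrE.
exact: (le_bigmax _ (fun ij : 'I_1 * 'I_n => `|v ij.1 ij.2|) (0, j)).
Qed.

Lemma norm_le_coord v c : 0 <= c -> (forall j, `|v 0 j| <= c) -> `|v| <= c.
Proof.
move=> c0 vc; rewrite [leLHS]mx_normrE.
by apply: bigmax_le => // -[i j] _ /=; rewrite ord1.
Qed.

End row_vector_norm.

(* Joins the completeness of row vectors with their norm, as required by the
   Banach fixed-point theorem. *)
HB.instance Definition _ (R : realType) (n : nat) := Complete.on 'rV[R]_n.

Definition infsup (R : realType) (A B : Type) (X : A * B -> R) : R :=
  inf [set sup [set X (a, b) | a in [set: A]] | b in [set: B]].

Section infsup_theory.
Context (R : realType) (A B : Type) (a0 : A) (b0 : B).
Implicit Types (X Y : A * B -> R) (C c : R).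

Lemma has_ubound_bounded C X b : (forall p, `|X p| <= C) ->
  has_ubound [set X (a, b) | a in [set: A]].
Proof.
by move=> XC; exists C => _ [a _ <-]; exact: le_trans (ler_norm _) (XC _).
Qed.

Lemma le_sup_bounded C X a b : (forall p, `|X p| <= C) ->
  X (a, b) <= sup [set X (a', b) | a' in [set: A]].
Proof. by move=> XC; apply: (ub_le_sup (has_ubound_bounded b XC)); exists a. Qed.

Lemma infsup_le_sup C X b : (forall p, `|X p| <= C) ->
  infsup X <= sup [set X (a, b) | a in [set: A]].
Proof.
move=> XC; apply: ge_inf; last by exists b.
exists (- C) => _ [b' _ <-]; apply: le_trans (le_sup_bounded a0 b' XC).
by have := XC (a0, b'); rewrite ler_norml => /andP[].
Qed.

(** Pointwise comparison passes through [sup] and [inf] only for bounded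
    families: over the reals both are junk values on unbounded sets. *)
Lemma infsup_le_shift C X Y c : (forall p, `|X p| <= C) ->
  (forall p, `|Y p| <= C) -> (forall p, X p <= Y p + c) ->
  infsup X <= infsup Y + c.
Proof.
move=> XC YC XY; rewrite -lerBlDr; apply: lb_le_inf.
  by exists (sup [set Y (a, b0) | a in [set: A]]), b0.
move=> _ [b _ <-]; rewrite lerBlDr; apply: le_trans (infsup_le_sup b XC) _.
apply: ge_sup; first by exists (X (a0, b)), a0.
move=> _ [a _ <-]; apply: le_trans (XY _) _; rewrite lerD2r.
exact: le_sup_bounded a b YC.
Qed.

Lemma infsup_cst c : infsup (fun _ : A * B => c) = c.
Proof.
rewrite /infsup; have -> : [set sup [set c | a in [set: A]] | b in [set: B]] = [set c].
  have -> : [set c | a in [set: A]] = [set c].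
    by apply/seteqP; split=> [_ [_ _ <-]//|_ ->]; exists a0.
  by rewrite sup1; apply/seteqP; split=> [_ [_ _ <-]//|_ ->]; exists b0.
exact: inf1.
Qed.

End infsup_theory.

Section implicit_step.
Context (R : realType) (A B : Type) (a0 : A) (b0 : B) (n : nat).
Variables (a : A * B -> 'I_n -> 'I_n -> R) (q : A * B -> 'I_n -> R).
Variables (u : 'rV[R]_n) (h L : R).
Hypothesis h_gt0 : 0 < h.
Hypothesis L_ge0 : 0 <= L.
Hypothesis offdiag : forall p l m, l != m -> a p l m <= 0.
Hypothesis rowsum : forall p l, 0 <= \sum_m a p l m.
Hypothesis a_bounded : forall p l m, `|a p l m| <= L.
Hypothesis q_bounded : forall p l, `|q p l| <= L.

Let X (w : 'rV[R]_n) (l : 'I_n) (p : A * B) : R :=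
  q p l + \sum_m a p l m * w 0 m.

Lemma bounded_row (w : 'rV[R]_n) : exists C : R, forall l p, `|X w l p| <= C.
Proof.
exists (L + \sum_m L * `|w 0 m|) => l p; apply: le_trans (ler_normD _ _) _.
apply: lerD (q_bounded _ _) _; apply: le_trans (ler_norm_sum _ _ _) _.
by apply: ler_sum => m _; rewrite normrM ler_wpM2r// a_bounded.
Qed.

(** Since the off-diagonal entries are non-positive, the sum over [m] of
    [a_lm (d - (w_m - w'_m))] is at most its diagonal term, and the non-negative
    row sum allows the constant [d] to be inserted into the sum. *)
Lemma row_decrement (w w' : 'rV[R]_n) l p d : 0 <= d -> (forall m, w 0 m - w' 0 m <= d) ->
  X w' l p <= X w l p + L * (d - (w 0 l - w' 0 l)).
Proof.
move=> d_ge0 ww'; rewrite /X -addrA lerD2l -lerBlDl -sumrB.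
apply: le_trans (_ : \sum_m a p l m * (d - (w 0 m - w' 0 m)) <= _).
  rewrite -subr_ge0 -sumrB (eq_bigr (fun m => a p l m * d)); last by move=> m _; ring.
  by rewrite -mulr_suml mulr_ge0.
rewrite (bigD1 l)//= -[leRHS]addr0 lerD//.
  by rewrite ler_wpM2r ?subr_ge0// (le_trans (ler_norm _)).
apply: sumr_le0 => m; rewrite eq_sym => lm.
by rewrite mulr_le0_ge0 ?subr_ge0 ?offdiag.
Qed.

(* This damping makes [1 - tau = tau h L], so that the terms in [w_l - w'_l]
   cancel in the contraction estimate. *)
Let tau := (1 + h * L)^-1.

Let step (w : 'rV[R]_n) : 'rV[R]_n :=
  \row_l (w 0 l - tau * (w 0 l - u 0 l + h * infsup (X w l))).

Lemma step_le (w w' : 'rV[R]_n) l :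
  step w 0 l - step w' 0 l <= (1 - tau) * `|w - w'|.
Proof.
set d := `|w - w'|.
have hL : 0 < 1 + h * L by rewrite ltr_wpDr// mulr_ge0// ltW.
have tau_gt0 : 0 < tau by rewrite invr_gt0.
have tau1 : tau + tau * h * L = 1.
  by rewrite -mulrA -[X in X + _]mulr1 -mulrDr mulVf// gt_eqF.
have ww' m : w 0 m - w' 0 m <= d.
  by have := coord_le_norm (w - w') m; rewrite !mxE; apply/le_trans/ler_norm.
have [C1 XC1] := bounded_row w; have [C2 XC2] := bounded_row w'.
have XC v p : v = w \/ v = w' -> `|X v l p| <= Num.max C1 C2.
  by case=> ->; rewrite le_max ?XC1 ?XC2 ?orbT.
have le_is := infsup_le_shift (X := X w' l) (Y := X w l) a0 b0
  (fun p => XC _ p (or_intror erefl)) (fun p => XC _ p (or_introl erefl))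
  (fun p => row_decrement l p (normr_ge0 _) ww').
rewrite !mxE.
set i := infsup _; set i' := infsup _.
have : tau * h * (i' - i) <= tau * h * (L * (d - (w 0 l - w' 0 l))).
  by apply: ler_wpM2l; [rewrite mulr_ge0// ltW|rewrite lerBlDl].
have -> : 1 - tau = tau * h * L by rewrite -tau1; ring.
have -> : w 0 l - tau * (w 0 l - u 0 l + h * i) -
 (w' 0 l - tau * (w' 0 l - u 0 l + h * i')) = (1 - tau) * (w 0 l - w' 0 l) + tau * h * (i' - i)
  by ring.
have -> : 1 - tau = tau * h * L by rewrite -tau1; ring.
move=> /(lerD (lexx (tau * h * L * (w 0 l - w' 0 l)))) /le_trans; apply.
by rewrite le_eqVlt; apply/orP; left; apply/eqP; ring.
Qed.

Lemma step_contraction (w w' : 'rV[R]_n) : `|step w - step w'| <= (1 - tau) * `|w - w'|.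
Proof.
have hL : 1 <= 1 + h * L by rewrite lerDl mulr_ge0// ltW.
apply: norm_le_coord => [|l].
  by rewrite mulr_ge0// subr_ge0 invf_le1// (lt_le_trans ltr01).
rewrite ler_norml !mxE; apply/andP; split; last first.
  by have := step_le w w' l; rewrite !mxE.
by rewrite lerNl opprB; have := step_le w' w l; rewrite !mxE distrC.
Qed.

Lemma implicit_step_unique_solution : exists! w : 'rV[R]_n, forall l,
  - ((u 0 l - w 0 l) / h) +
    infsup (fun p => q p l + \sum_m a p l m * w 0 m) = 0.
Proof.
have hL : 0 < 1 + h * L by rewrite ltr_wpDr// mulr_ge0// ltW.
have tau_gt0 : 0 < tau by rewrite invr_gt0.
have tau_le1 : tau <= 1 by rewrite invf_le1// lerDl mulr_ge0// ltW.
have stepS : set_fun [set: 'rV[R]_n] [set: 'rV[R]_n] step by [].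
have ctr : is_contraction (mkfun stepS).
  have q0 : 0 <= 1 - tau by rewrite subr_ge0.
  exists (NngNum q0); split; first by rewrite /= gtrBl.
  by move=> [w w'] _; exact: step_contraction.
have fixP w : (w = step w) <-> forall l, - ((u 0 l - w 0 l) / h) +
    infsup (fun p => q p l + \sum_m a p l m * w 0 m) = 0.
  have defect l : w 0 l - step w 0 l = tau * h * (- ((u 0 l - w 0 l) / h) +
      infsup (fun p => q p l + \sum_m a p l m * w 0 m)).
    by rewrite mxE; field; rewrite gt_eqF.
  split=> [wE l|wE]; last first.
    by apply/rowP => l; apply/eqP; rewrite -subr_eq0 defect wE mulr0.
  apply/eqP; have /eqP := defect l; rewrite -wE subrr eq_sym mulf_eq0 => /orP[|//].
  by rewrite gt_eqF// mulr_gt0.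
have [||w _ wE] := @banach_fixed_point R 'rV[R]_n setT (mkfun stepS) ctr; first exact: closedT.
  by exists 0.
exists w; split; first exact/fixP.
move=> w' /fixP w'E.
exact: (contraction_fixpoint_unique ctr).
Qed.

End implicit_step.

(** * Lebesgue measure and essentially bounded functions on row vectors *)

Section lebesgue_measure_rV.
Context {R : realType} {n : nat}.
Implicit Types (x y : 'rV[R]_n) (U : set 'rV[R]_n).

Lemma rV_ballE x e : 0 < e ->
  ball x e = [set y : 'rV[R]_n | forall i, ball (x 0 i) e (y 0 i)].
Proof.
move=> e0; apply/seteqP; split=> y /=; first by move=> [_ xy] i; exact: xy.
by move=> xy; split=> // i j; rewrite ord1.
Qed.

Lemma measurable_rV_ball x e : 0 < e -> measurable (ball x e).
Proof.
move=> e0; rewrite rV_ballE//.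
rewrite (_ : mkset _ = \bigcap_(i in [set: 'I_n])
    (@rV_coord R n i @^-1` ball (x 0 i) e)); last first.
  by apply/seteqP; split=> y /= xy i => [_|]; exact: xy.
apply: fin_bigcap_measurable => [|i _]; first exact: finite_finset.
have := @measurable_rV_coord R n i measurableT _ (measurable_ball (x 0 i) e).
by rewrite setTI.
Qed.

Lemma lebesgue_rV_ball x e : 0 < e ->
  lebesgue_rV (ball x e) = ((e *+ 2) ^+ n)%:E.
Proof.
move=> e0; rewrite rV_ballE//.
rewrite (@lebesgue_rV_box R n (fun i => ball (x 0 i) e)); last first.
  by move=> i; exact: measurable_ball.
under eq_bigr => i _ do rewrite lebesgue_measure_ball ?ltW//.
by rewrite prodEFin prodr_const card_ord.
Qed.

Lemma rat_approximation x r : 0 < r ->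
  exists q : 'rV[rat]_n, forall i, ball (x 0 i) r (ratr (q 0 i) : R).
Proof.
move=> r0; suff /choice[q qP] : forall i, exists q : rat, ball (x 0 i) r (ratr q : R).
  by exists (\row_i q i) => i; rewrite mxE.
move=> i; have xr : x 0 i < x 0 i + r by rewrite ltrDl.
have [q] := rat_in_itvoo xr.
rewrite in_itv/= => /andP[xq qx]; exists q.
by rewrite /ball/= ltr_norml; apply/andP; split; lra.
Qed.

(** Second countability, through the balls with rational center and radius
    [1 / (k + 1)] that the open set contains. *)
Lemma open_measurable_rV U : open U -> measurable U.
Proof.
move=> oU.
pose c (i : 'rV[rat]_n * nat) : 'rV[R]_n := map_mx ratr i.1.
pose V (i : 'rV[rat]_n * nat) : set 'rV[R]_n :=
  if `[< ball (c i) i.2.+1%:R^-1 `<=` U >] then ball (c i) i.2.+1%:R^-1 else set0.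
rewrite (_ : U = \bigcup_i V i); last first.
  apply/seteqP; split=> x; last first.
    by move=> [i _]; rewrite /V; case: ifPn => // /asboolP; apply.
  move=> Ux; have /nbhs_ballP[e/= e0 xeU] := open_nbhs_nbhs (conj oU Ux).
  have [k ke] := @ltr_add_invr R 0 (e / 2) (divr_gt0 e0 (ltr0Sn _ 1)).
  rewrite add0r in ke.
  have k0 : 0 < k.+1%:R^-1 :> R by rewrite invr_gt0.
  have [q qP] := rat_approximation x k0.
  exists (q, k) => //; rewrite /V; case: asboolP => [_|[]]/=.
    rewrite rV_ballE// => i; apply: ball_sym; rewrite mxE; exact: qP.
  move=> y; rewrite rV_ballE// => qy; apply: xeU; rewrite rV_ballE// => i.
  have := qy i; have := qP i; rewrite mxE => xq /(ball_triangle xq).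
  by apply: le_ball; move: k.+1%:R^-1 ke => r; lra.
apply: countable_bigcupT_measurable => // i.
by rewrite /V; case: ifPn => _ //; apply: measurable_rV_ball; rewrite invr_gt0.
Qed.

Lemma continuous_measurable_rV U (f : 'rV[R]_n -> R) :
  open U -> {in U, continuous f} -> measurable_fun U f.
Proof.
move=> oU cf; apply: (measurability _ (RGenOpens.measurableE R)).
move=> _ [_ [a [b ->] <-]]; apply: open_measurable_rV.
rewrite openE => x [Ux abx].
apply: filterI; first exact: open_nbhs_nbhs.
apply: (cf x (mem_set Ux)); apply: open_nbhs_nbhs; split => //.
Qed.

Lemma bounded_lebesgue_rV U : measurable U -> bounded_set U ->
  (lebesgue_rV U < +oo)%E.
Proof.
move=> mU [M [_ UM]].
have r0 : 0 < `|M| + 2 by rewrite ltr_wpDl.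
apply: (@le_lt_trans _ _ (lebesgue_rV (ball (0 : 'rV[R]_n) (`|M| + 2)))).
  apply: le_measure; rewrite ?inE//; first exact: measurable_rV_ball.
  move=> x Ux; rewrite -ball_normE/= sub0r normrN.
  apply: (@le_lt_trans _ _ (`|M| + 1)); last by rewrite ltrD2l ltr1n.
  by apply: UM => //; rewrite (le_lt_trans (ler_norm _))// ltrDl.
by rewrite lebesgue_rV_ball// ltry.
Qed.

(** A null set cannot contain a ball. *)
Lemma ae_dense U (P : 'rV[R]_n -> Prop) x : open U -> U x ->
  {ae lebesgue_rV, forall y, P y} -> exists2 y, U y & P y.
Proof.
move=> oU Ux [N [mN N0 PN]]; apply: contrapT => UP.
have /nbhs_ballP[e/= e0 xeU] := open_nbhs_nbhs (conj oU Ux).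
have : (lebesgue_rV (ball x e) <= lebesgue_rV N)%E.
  apply: le_measure; rewrite ?inE//; first exact: measurable_rV_ball.
  by move=> y /xeU Uy; apply: PN => /= Py; apply: UP; exists y.
by rewrite N0 lebesgue_rV_ball// lee_fin leNgt exprn_gt0// mulrn_wgt0.
Qed.

Lemma Linf_norm_le_ae U (f : 'rV[R]_n -> R) (c : R) :
  (Linf_norm U f <= c%:E)%E ->
  {ae lebesgue_rV, forall x, U x -> `|f x| <= c}.
Proof.
rewrite /Linf_norm unlock; case: ifPn => [_ /ess_supP|/negP[]].
  by apply: filterS => x /= + Ux; rewrite lee_fin /patch mem_set.
apply: (@lt_le_trans _ _ (lebesgue_rV (ball (0 : 'rV[R]_n) 1))).
  by rewrite lebesgue_rV_ball// lte_fin exprn_gt0.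
by apply: le_measure; rewrite ?inE//; exact: measurable_rV_ball.
Qed.

End lebesgue_measure_rV.

Section ess_bounded.
Context d {T : measurableType d} {R : realType}.
Variables (mu : {measure set T -> \bar R}) (D : set T).
Implicit Types (f g : T -> R) (c : R).
Hypotheses (mD : measurable D) (muD : (mu D < +oo)%E).

(** Carrying the bound [c] explicitly lets it be shared by all members of a
    family of functions. *)
Definition ess_bounded f c :=
  measurable_fun D f /\ {ae mu, forall x, D x -> `|f x| <= c}.

Lemma ess_bounded_cst c : ess_bounded (fun=> c) `|c|.
Proof. by split; [exact: measurable_cst|exact: aeW]. Qed.

Lemma ess_boundedN f c : ess_bounded f c -> ess_bounded (fun x => - f x) c.
Proof.
move=> [mf fc]; split; first exact: measurableT_comp.
by apply: filterS fc => x + Dx; rewrite normrN; apply.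
Qed.

Lemma ess_boundedD f g c c' : ess_bounded f c -> ess_bounded g c' ->
  ess_bounded (fun x => f x + g x) (c + c').
Proof.
move=> [mf fc] [mg gc]; split; first exact: measurable_funD.
apply: filterS2 fc gc => x fc gc Dx.
by rewrite (le_trans (ler_normD _ _))// lerD ?fc ?gc.
Qed.

Lemma ess_boundedM f g c c' : ess_bounded f c -> ess_bounded g c' ->
  ess_bounded (fun x => f x * g x) (c * c').
Proof.
move=> [mf fc] [mg gc]; split; first exact: measurable_funM.
apply: filterS2 fc gc => x fc gc Dx.
by rewrite normrM ler_pM ?fc ?gc.
Qed.

Lemma ess_bounded_sum (I : Type) (s : seq I) (f : I -> T -> R) (c : I -> R) :
  (forall i, ess_bounded (f i) (c i)) ->
  ess_bounded (fun x => \sum_(i <- s) f i x) (\sum_(i <- s) c i).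
Proof.
move=> fc; elim: s => [|i s IH].
  rewrite big_nil; under eq_fun do rewrite big_nil.
  by have := ess_bounded_cst 0; rewrite normr0.
rewrite big_cons; under eq_fun do rewrite big_cons.
exact: ess_boundedD (fc i) IH.
Qed.

Lemma ess_bounded_integrable f c : ess_bounded f c ->
  mu.-integrable D (EFin \o f).
Proof.
move=> [mf fc]; apply/integrableP; split; first exact/measurable_EFinP.
apply: (@le_lt_trans _ _ (`|c|%:E * mu D)%E).
  apply: integral_le_bound => //; first exact/measurable_EFinP.
  by apply: filterS fc => x + Dx; rewrite lee_fin => /(_ Dx)/le_trans; apply; exact: ler_norm.
by rewrite lte_mul_pinfty.
Qed.

Lemma ess_bounded_integral f c : 0 <= c -> ess_bounded f c ->
  `|\int[mu]_(x in D) f x| <= c * fine (mu D).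
Proof.
move=> c0 fb; have [mf fc] := fb.
have muDE : mu D = (fine (mu D))%:E by rewrite fineK// ge0_fin_numE.
rewrite -lee_fin (EFin_normr_Rintegral mD (ess_bounded_integrable fb)).
apply: le_trans (le_abse_integral _ mD _) _; first exact/measurable_EFinP.
rewrite EFinM -muDE; apply: integral_le_bound => //.
exact/measurable_EFinP.
Qed.

End ess_bounded.

(** * Euclidean vectors and Lipschitz domains *)

Section euclidean_lemmas.
Context {R : realType} {n : nat}.
Implicit Types (x y u v : 'rV[R]_n).

Lemma dotvDr u v w : dotv u (v + w) = dotv u v + dotv u w.
Proof. by rewrite /dotv -big_split/=; apply: eq_bigr => j _; rewrite mxE mulrDr. Qed.

Lemma dotvZr (a : R) u v : dotv u (a *: v) = a * dotv u v.
Proof. by rewrite /dotv mulr_sumr; apply: eq_bigr => j _; rewrite mxE mulrCA. Qed.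

Lemma dotvC u v : dotv u v = dotv v u.
Proof. by apply: eq_bigr => j _; rewrite mulrC. Qed.

Lemma dotvDl u v w : dotv (v + w) u = dotv v u + dotv w u.
Proof. by rewrite dotvC dotvDr !(dotvC u). Qed.

Lemma dotvZl (a : R) u v : dotv (a *: v) u = a * dotv v u.
Proof. by rewrite dotvC dotvZr (dotvC u). Qed.

Lemma dotv_sumr (I : Type) (s : seq I) u (v : I -> 'rV[R]_n) :
  dotv u (\sum_(i <- s) v i) = \sum_(i <- s) dotv u (v i).
Proof.
apply: (big_morph (dotv u)); first exact: dotvDr.
by rewrite /dotv big1// => j _; rewrite mxE mulr0.
Qed.

Lemma dotv_le u v : `|dotv u v| <= n%:R * `|u| * `|v|.
Proof.
apply: le_trans (ler_norm_sum _ _ _) _.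
apply: (@le_trans _ _ (\sum_(j < n) `|u| * `|v|)).
  apply: ler_sum => j _; rewrite normrM.
  by apply: ler_pM => //; exact: coord_le_norm.
by rewrite sumr_const card_ord -mulrA mulr_natl.
Qed.

Lemma enorm_le u : enorm u <= Num.sqrt n%:R * `|u|.
Proof.
rewrite -(@ger0_norm _ `|u|)// -sqrtr_sqr -sqrtrM ?ler0n//.
apply: ler_wsqrtr; rewrite expr2 mulrA.
exact: le_trans (ler_norm _) (dotv_le _ _).
Qed.

Lemma enorm_coord_le u j : `|u 0 j| <= enorm u.
Proof.
rewrite -sqrtr_sqr; apply: ler_wsqrtr; rewrite /dotv (bigD1 j)//= -expr2 lerDl.
by apply: sumr_ge0 => k _; rewrite -expr2 sqr_ge0.
Qed.

(** At a boundary point [x0] in the interior of the closure, the point slightly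
    below [x0] in the vertical direction would lie in the closure, although
    near it the graph function is strictly above the vertical coordinate. *)
Lemma interior_closure_lipschitz_domain (Omega : set 'rV[R]_n) :
  bounded_lipschitz_domain Omega -> interior (closure Omega) `<=` Omega.
Proof.
move=> [oO _ _ _ lip] x0 intx0; apply: contrapT => Ox0.
have [|nu [r [L [psi [nu1 r0 psiL graph]]]]] := lip x0.
  by split; [exact: interior_subset intx0|move=> /interior_subset].
have dnu : dotv nu nu = 1.
  have d0 : 0 <= dotv nu nu by apply: sumr_ge0 => k _; rewrite -expr2 sqr_ge0.
  by rewrite -(sqr_sqrtr d0) -/(enorm nu) nu1 expr1n.
pose F x := psi (x - dotv x nu *: nu) - dotv x nu.
pose c1 : R := Num.sqrt n%:R.
pose k := n%:R * `|nu|.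
pose C := `|L| * (c1 * (1 + k * `|nu|)) + k.
have C0 : 0 <= C by rewrite addr_ge0 ?mulr_ge0 ?addr_ge0 ?mulr_ge0 ?sqrtr_ge0.
have FC x u : F x - C * `|u| <= F (x + u).
  have du : `|dotv u nu| <= k * `|u| by rewrite (le_trans (dotv_le _ _))// mulrAC.
  have e1 : enorm (u - dotv u nu *: nu) <= c1 * ((1 + k * `|nu|) * `|u|).
    apply: le_trans (enorm_le _) _; apply: ler_wpM2l; first exact: sqrtr_ge0.
    apply: le_trans (ler_normB _ _) _; rewrite mulrDl mul1r lerD2l normrZ.
    by rewrite mulrAC ler_wpM2r.
  have : `|psi (x + u - dotv (x + u) nu *: nu) - psi (x - dotv x nu *: nu)|
      <= `|L| * (c1 * ((1 + k * `|nu|) * `|u|)).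
    apply: le_trans (psiL _ _) _.
    rewrite (_ : _ - _ = u - dotv u nu *: nu); last first.
      rewrite dotvDl scalerDl.
      by rewrite opprD opprB addrACA [x + u]addrC addrACA; apply/rowP => j; rewrite !mxE; ring.
    apply: le_trans (_ : `|L| * enorm (u - dotv u nu *: nu) <= _); last first.
      by rewrite ler_wpM2l.
    by rewrite ler_wpM2r ?sqrtr_ge0 ?ler_norm.
  rewrite /F /C dotvDl.
  move: du; rewrite !ler_norml => /andP[du1 du2] /andP[p1 p2]; lra.
have [e/= e0 xe] := (nbhs_ballP _ _).1 intx0.
(* [s] is the distance by which [x0] is moved down: small enough to stay in the
   ball [ball x0 e] and, with room for an error [d <= s], in the chart. *)
pose s := Num.min (e / (2 * (`|nu| + 1))) (r / (2 * (c1 + 1) * (1 + `|nu|))).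
have nu0 : 0 < `|nu| + 1 by rewrite ltr_wpDl.
have nu0' : 0 < 1 + `|nu| by rewrite addrC.
have c10 : 0 <= c1 by exact: sqrtr_ge0.
have c1_gt0 : 0 < c1 + 1 by rewrite ltr_wpDl.
have s0 : 0 < s.
  by rewrite lt_min !divr_gt0// !mulr_gt0.
have se : s * `|nu| < e.
  have : s <= e / (2 * (`|nu| + 1)) by rewrite ge_min lexx.
  rewrite ler_pdivlMr ?mulr_gt0// => h.
  have := normr_ge0 nu; nra.
have sr : c1 * (s * (1 + `|nu|)) < r.
  have : s <= r / (2 * (c1 + 1) * (1 + `|nu|)) by rewrite ge_min lexx orbT.
  rewrite ler_pdivlMr ?mulr_gt0// => h.
  have h2 : 0 < s * (1 + `|nu|) by rewrite mulr_gt0.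
  nra.
pose xs := x0 - s *: nu.
have clxs : closure Omega xs.
  apply: xe; rewrite -ball_normE/= /xs opprB addrC subrK normrZ gtr0_norm//.
pose d := Num.min s (s / (C + 1)).
have C1 : 0 < C + 1 by rewrite ltr_wpDl.
have d0 : 0 < d by rewrite lt_min s0 divr_gt0.
have [y [Oy]] := clxs _ (nbhsx_ballx xs d d0).
rewrite -ball_normE/= distrC => yd.
have yE : y = xs + (y - xs) by rewrite addrC subrK.
set u := y - xs in yd yE.
have us : `|u| < s by rewrite (lt_le_trans yd)// ge_min lexx.
have uC : C * `|u| < s.
  have : `|u| <= s / (C + 1) by rewrite (le_trans (ltW yd))// ge_min lexx orbT.
  rewrite ler_pdivlMr// => h.
  have [->|un0] := eqVneq `|u| 0; first by rewrite mulr0.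
  have : 0 < `|u| by rewrite lt_def un0/=.
  lra.
have yr : enorm (y - x0) < r.
  apply: le_lt_trans (enorm_le _) _; apply: le_lt_trans sr.
  apply: ler_wpM2l => //; rewrite yE /xs.
  rewrite (_ : x0 - s *: nu + u - x0 = u - s *: nu); last first.
    by apply/rowP => j; rewrite !mxE; ring.
  apply: le_trans (ler_normB _ _) _; rewrite mulrDr mulr1 normrZ gtr0_norm//.
  by rewrite lerD2r ltW.
have Fxs : s <= F xs.
  have psi0 : dotv x0 nu <= psi (x0 - dotv x0 nu *: nu).
    rewrite leNgt; apply/negP => h; apply: Ox0; apply/graph => //.
    by rewrite subrr /enorm /dotv big1 ?sqrtr0// => j _; rewrite mxE mul0r.
  rewrite /F /xs dotvDl -scaleNr dotvZl dnu mulr1.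
  rewrite (_ : _ + _ - _ = x0 - dotv x0 nu *: nu); last first.
    by apply/rowP => j; rewrite !mxE; ring.
  by rewrite opprB addrCA lerDl subr_ge0; exact: psi0.
have Fy : F y < 0 by rewrite subr_lt0; exact: (graph y yr).1 Oy.
have := FC xs u; rewrite -yE => /le_lt_trans/(_ Fy); rewrite subr_lt0.
by move=> /(le_lt_trans Fxs)/lt_trans/(_ uC); rewrite ltxx.
Qed.

End euclidean_lemmas.

(** * Nodal expansions and boundary traces of finite element functions *)

Section finite_element_functions.
Context {R : realType} {n : nat} (Omega : set 'rV[R]_n) (M : mesh R n).
Variable phi : 'I_(nb_nodes M) -> 'rV[R]_n -> R.
Hypotheses (hM : simplicial_mesh Omega M) (hphi : hat_functions Omega phi).
Implicit Types (w z : 'rV[R]_n -> R) (K : {set 'I_(nb_nodes M)}).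

Lemma hull_closure K : K \in cells M -> hull K `<=` closure Omega.
Proof. by move=> MK x Kx; case: hM => _ _ _ _ <-; exists K. Qed.

Lemma closure_hull x : closure Omega x -> exists2 K, K \in cells M & hull K x.
Proof. by case: hM => _ _ _ _ <- [K MK Kx]; exists K. Qed.

Lemma hull_node K m : m \in K -> hull K (node m).
Proof.
move=> Km; exists (fun j => (j == m)%:R); split.
- by move=> j; exact: ler0n.
- by move=> j jK; case: eqP jK => // ->; rewrite Km.
- by rewrite (bigD1 m)//= eqxx big1 ?addr0// => j /negbTE ->.
- rewrite (bigD1 m)//= eqxx scale1r big1 ?addr0// => j /negbTE ->.
  by rewrite scale0r.
Qed.

Lemma closure_node m : closure Omega (@node R n M m).
Proof. by case: hM => _ /(_ m)[K MK /hull_node/(hull_closure MK)]. Qed.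

Lemma fe_space_hullE w K x (lam : 'I_(nb_nodes M) -> R) :
  fe_space Omega M w -> K \in cells M -> (forall m, 0 <= lam m) ->
  (forall m, m \notin K -> lam m = 0) -> \sum_m lam m = 1 ->
  x = \sum_m lam m *: node m -> w x = \sum_m lam m * w (node m).
Proof.
move=> [_ _ aff] MK lam0 lamK lam1 xE; have [p [c wE]] := aff K MK.
rewrite wE; last by exists lam.
rewrite -[c]mul1r -lam1 mulr_suml xE dotv_sumr -big_split/=.
apply: eq_bigr => m _; rewrite dotvZr -mulrDr.
by have [/hull_node/wE ->//|/lamK ->] := boolP (m \in K); rewrite !mul0r.
Qed.

Lemma hat_hullE K m x (lam : 'I_(nb_nodes M) -> R) :
  K \in cells M -> (forall m, 0 <= lam m) ->
  (forall m, m \notin K -> lam m = 0) -> \sum_m lam m = 1 ->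
  x = \sum_m lam m *: node m -> phi m x = lam m.
Proof.
move=> MK lam0 lamK lam1 xE; have [phiV phiE] := hphi m.
rewrite (fe_space_hullE phiV MK lam0 lamK lam1 xE) (bigD1 m)//= phiE eqxx mulr1.
by rewrite big1 ?addr0// => j; rewrite phiE eq_sym => /negbTE ->; rewrite mulr0.
Qed.

Lemma fe_space_nodal w x : fe_space Omega M w ->
  w x = \sum_m w (node m) * phi m x.
Proof.
move=> wV; have [wout _ _] := wV.
have [/closure_hull[K MK [lam [lam0 lamK lam1 xE]]]|Ox] := pselect (closure Omega x).
  rewrite (fe_space_hullE wV MK lam0 lamK lam1 xE); apply: eq_bigr => m _.
  by rewrite (hat_hullE _ MK lam0 lamK lam1 xE) mulrC.
rewrite wout// big1// => m _; have [[-> //]] := hphi m.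
by rewrite mulr0.
Qed.

Lemma hat_ge0 m x : 0 <= phi m x.
Proof.
have [/closure_hull[K MK [lam [lam0 lamK lam1 xE]]]|Ox] := pselect (closure Omega x).
  by rewrite (hat_hullE _ MK lam0 lamK lam1 xE).
by have [[-> //]] := hphi m.
Qed.

Lemma sum_hat x : closure Omega x -> \sum_m phi m x = 1.
Proof.
move=> /closure_hull[K MK [lam [lam0 lamK lam1 xE]]].
by rewrite -lam1; apply: eq_bigr => m _; rewrite (hat_hullE _ MK lam0 lamK lam1 xE).
Qed.

Lemma fe_spaceD w z : fe_space Omega M w -> fe_space Omega M z ->
  fe_space Omega M (fun x => w x + z x).
Proof.
move=> [w0 wc wa] [z0 zc za]; split.
- by move=> x Ox; rewrite w0// z0// addr0.
- by move=> x; apply: cvgD; [exact: wc|exact: zc].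
- move=> K MK; have [p [c wE]] := wa K MK; have [q [b zE]] := za K MK.
  exists (p + q), (c + b) => x Kx.
  by rewrite wE// zE// dotvDl addrACA.
Qed.

Lemma fe_spaceZ (a : R) w : fe_space Omega M w ->
  fe_space Omega M (fun x => a * w x).
Proof.
move=> [w0 wc wa]; split.
- by move=> x Ox; rewrite w0// mulr0.
- by move=> x; apply: cvgMr; exact: wc.
- move=> K MK; have [p [c wE]] := wa K MK; exists (a *: p), (a * c) => x Kx.
  by rewrite wE// dotvZl mulrDr.
Qed.

Lemma fe_space0_in : fe_space Omega M (fun=> 0).
Proof.
split=> //; first by move=> x; exact: cvg_cst.
move=> K _; exists 0, 0 => x _.
by rewrite addr0 /dotv big1// => j _; rewrite mxE mul0r.
Qed.

Lemma fe_space_sum (I : Type) (s : seq I) (c : I -> R) (w : I -> 'rV[R]_n -> R) :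
  (forall i, fe_space Omega M (w i)) ->
  fe_space Omega M (fun x => \sum_(i <- s) c i * w i x).
Proof.
move=> wV; elim: s => [|i s IH].
  by under eq_fun do rewrite big_nil; exact: fe_space0_in.
under eq_fun do rewrite big_cons; apply: fe_spaceD IH; exact: fe_spaceZ.
Qed.

Lemma fe_space_continuous w x : open Omega -> fe_space Omega M w ->
  Omega x -> {for x, continuous w}.
Proof.
move=> oO [_ wc _] Ox.
have := continuous_subspaceW (@subset_closure _ Omega) wc.
by rewrite continuous_open_subspace// => /(_ x (mem_set Ox)).
Qed.

(** The dilation [H] of ratio [e] centered at the node [y] maps [x] into
    [Omega], where the hat function of [y] exceeds [1 - e] near [H x].  A point
    [H z] near [H x] therefore lies in a cell with vertex [y], with a coordinate
    at [y] so large that [z] itself has non-negative barycentric coordinates in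
    that cell. *)
Lemma hat_gt0_interior m x : open Omega -> Omega (node m) -> 0 < phi m x ->
  closure Omega x -> interior (closure Omega) x.
Proof.
move=> oO Om phix clx; set y := node m in Om *.
have [K MK Kx] := closure_hull clx.
have [lam [lam0 lamK lam1 xE]] := Kx.
have phiE : phi m x = lam m by exact: hat_hullE MK lam0 lamK lam1 xE.
have [r/= r0 yr] := (nbhs_ballP _ _).1 (open_nbhs_nbhs (conj oO Om)).
have rx : 0 < r + `|x - y| + 1 by rewrite ltr_wpDl// addr_ge0// ltW.
pose e := r / (r + `|x - y| + 1).
have e0 : 0 < e by rewrite divr_gt0.
have e1 : e < 1 by rewrite ltr_pdivrMr// mul1r -addrA ltrDl ltr_wpDl.
pose H (z : 'rV[R]_n) : 'rV[R]_n := y + e *: (z - y).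
have OHx : Omega (H x).
  apply: yr; rewrite -ball_normE/= /H opprD addNKr normrN normrZ gtr0_norm//.
  rewrite /e mulrAC ltr_pdivrMr//.
  have := normr_ge0 (x - y); nra.
have mK : m \in K by apply: contraLR phix => /lamK; rewrite phiE => ->; rewrite ltxx.
have phiHx : 1 - e < phi m (H x).
  have := @hat_hullE K m (H x) (fun j => e * lam j + (1 - e) * (j == m)%:R) MK.
  rewrite eqxx mulr1 => -> //.
  - by rewrite ltrDr mulr_gt0// -phiE.
  - by move=> j; rewrite addr_ge0// mulr_ge0 ?ler0n ?subr_ge0// ltW.
  - move=> j jK; rewrite lamK// mulr0 add0r; case: eqP jK => [->|]; first by rewrite mK.
    by rewrite mulr0.
  - rewrite big_split/= -!mulr_sumr lam1 (bigD1 m)//= eqxx big1 ?addr0 ?mulr1 ?subrKC//.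
    by move=> j /negbTE ->.
  - rewrite (eq_bigr (fun j => e *: (lam j *: node j) +
      (1 - e) *: ((j == m)%:R *: node j))); last first.
      by move=> j _; rewrite !scalerA -scalerDl.
    rewrite big_split/= -!scaler_sumr -xE (bigD1 m)//= eqxx scale1r big1 ?addr0.
      by rewrite /H scalerBr scalerBl scale1r addrCA addrA.
    by move=> j /negbTE ->; rewrite scale0r.
have Hc : H @ x --> H x.
  have F := nbhs_filter x.
  apply: (@cvgD _ _ _ (nbhs x) F (fun=> y)); first exact: cvg_cst.
  apply: (@cvgZl_tmp _ _ _ (nbhs x) F e (fun z : 'rV[R]_n => z - y)).
  by apply: (@cvgB _ _ _ (nbhs x) F id (fun=> y)); [exact: cvg_id|exact: cvg_cst].
have : \forall z \near x, Omega (H z) /\ 1 - e < phi m (H z).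
  apply: (Hc [set z | Omega z /\ 1 - e < phi m z]); apply: filterI.
    exact: open_nbhs_nbhs.
  have [phiV _] := hphi m.
  exact: (@cvgr_gt _ _ _ _ _ _ (fe_space_continuous oO phiV OHx)).
apply: filterS => z [OHz phiHz].
have [K' MK' [mu [mu0 muK mu1 HzE]]] := closure_hull (subset_closure OHz).
have phimu : phi m (H z) = mu m by exact: hat_hullE MK' mu0 muK mu1 HzE.
rewrite phimu in phiHz.
have mK' : m \in K'.
  by apply: contraLR phiHz => /muK ->; rewrite -leNgt subr_ge0 ltW.
apply: (hull_closure MK'); exists (fun j => (mu j - (1 - e) * (j == m)%:R) / e); split.
- move=> j; rewrite divr_ge0 ?(ltW e0)//.
  by case: eqP => [->|_]; rewrite ?mulr1 ?mulr0 ?subr0// subr_ge0 ltW.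
- move=> j jK; rewrite muK//; case: eqP jK => [->|_ _]; first by rewrite mK'.
  by rewrite mulr0 subrr mul0r.
- rewrite -mulr_suml sumrB mu1 -mulr_sumr (bigD1 m)//= eqxx big1 ?addr0.
    by rewrite mulr1 opprB addrC subrK divff// gt_eqF.
  by move=> j /negbTE ->.
- rewrite (eq_bigr (fun j => e^-1 *: (mu j *: node j) -
    (e^-1 * (1 - e)) *: ((j == m)%:R *: node j))); last first.
    by move=> j _; rewrite mulrC mulrBr scalerBl !scalerA mulrA.
  rewrite sumrB -!scaler_sumr -HzE (bigD1 m)//= eqxx scale1r big1 ?addr0.
    rewrite /H scalerDr scalerA mulVf ?gt_eqF// scale1r mulrBr mulr1 mulVf ?gt_eqF//.
    rewrite scalerBl scale1r opprB addrA addrC addrA -/y.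
    by apply/rowP => j; rewrite !mxE; ring.
  by move=> j /negbTE ->; rewrite scale0r.
Qed.

Hypothesis hOmega : bounded_lipschitz_domain Omega.

Lemma hat_bdry m x : Omega (node m) -> bdry Omega x -> phi m x = 0.
Proof.
move=> Om [clx nint]; have [oO _ _ _ _] := hOmega.
have [//|phi0] := eqVneq (phi m x) 0; exfalso; apply: nint.
have : Omega x.
  apply: interior_closure_lipschitz_domain => //.
  by apply: (hat_gt0_interior oO Om) => //; rewrite lt_def phi0 hat_ge0.
by move=> Ox; apply: open_nbhs_nbhs.
Qed.

Lemma bdry_node m : ~ Omega (@node R n M m) -> bdry Omega (@node R n M m).
Proof. by move=> Om; split; [exact: closure_node|move=> /interior_subset]. Qed.

(** On the boundary only the hat functions of boundary nodes contribute to the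
    nodal expansion. *)
Lemma fe_space_trace_nodal u w : fe_space Omega M u -> fe_space Omega M w ->
  (forall m, ~ Omega (@node R n M m) -> w (node m) = u (node m)) ->
  fe_space_trace Omega M u w.
Proof.
move=> uV wV wu; split=> // x bx; rewrite (fe_space_nodal x wV) (fe_space_nodal x uV).
apply: eq_bigr => m _; have [Om|/wu -> //] := pselect (Omega (node m)).
by rewrite hat_bdry// !mulr0.
Qed.

End finite_element_functions.

(** * Gradients of finite element functions and uniform bounds over the controls *)

Section affine_gradient.
Context {R : realType} {n : nat}.
Implicit Types (x p v : 'rV[R]_n) (w : 'rV[R]_n -> R).

Lemma dotv_delta p j : dotv p (delta_mx 0 j) = p 0 j.
Proof.
rewrite /dotv (bigD1 j)//= mxE !eqxx mulr1 big1 ?addr0// => k /negbTE kj.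
by rewrite mxE kj andbF mulr0.
Qed.

Lemma grad_affine w x p (c : R) :
  (\forall y \near x, w y = dotv p y + c) -> grad w x = p.
Proof.
move=> wE; apply/rowP => j; rewrite mxE /partial (near_eq_derive _ wE).
rewrite -dotv_delta; apply: cvg_lim => //.
apply: cvg_near_cst; near=> h.
have h0 : h != 0 by near: h; exact: nbhs_dnbhs_neq.
rewrite /= dotvDr dotvZr [X in _ *: X](_ : _ = h * dotv p (delta_mx 0 j)); last by ring.
by rewrite /GRing.scale/= mulKf.
Unshelve. all: by end_near. Qed.

End affine_gradient.

Section compact_uniform_bound.
Context {R : realType} {P : topologicalType}.

Lemma compact_uniform_bound (Q : R -> P -> Prop) :
  compact [set: P] -> (forall c c' p, c <= c' -> Q c p -> Q c' p) ->
  (forall p : P, exists c, \forall q \near p, Q c q) -> exists c, forall p, Q c p.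
Proof.
move=> /compact_near_coveringP cov mono loc.
have /= QT : \forall c \near +oo%R, [set: P] `<=` Q c.
  apply: cov => p _; have [c cq] := loc p.
  exists ([set q : P | Q c q], [set c' : R | c <= c']) => /=.
    by split=> //; apply: nbhs_pinfty_ge; exact: num_real.
  by move=> [q c'] /= [Qq cc']; exact: mono Qq.
have [c Qc] := filter_ex QT.
by exists c => p; exact: Qc.
Qed.

End compact_uniform_bound.

Section Linf_bounds.
Context {R : realType} {n : nat} {P : topologicalType}.
Variable Omega : set 'rV[R]_n.
Hypothesis oO : open Omega.
Notation bounded_fun := (ess_bounded (@lebesgue_rV R n) Omega).

Lemma Linf_norm_lty_ae (f : 'rV[R]_n -> R) : (Linf_norm Omega f < +oo)%E ->
  exists c, {ae lebesgue_rV, forall x, Omega x -> `|f x| <= c}.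
Proof.
move=> foo; exists (fine (Linf_norm Omega f)); apply: Linf_norm_le_ae.
by rewrite fineK// ge0_fin_numE// Lnorm_ge0.
Qed.

(** The sole consequence of continuity in the uniform norm on which the bounds
    over compact parameter sets rest. *)
Lemma cvg0_near_le1 (N : P -> \bar R) (p : P) :
  N q @[q --> p] --> 0%E -> \forall q \near p, (N q <= 1%:E)%E.
Proof.
move=> N0; apply: (N0 [set y | (y <= 1%:E)%E]).
exists 1 => //= y; rewrite /ball/= sub0r normrN lee_fin => /ltW.
exact/le_trans/ler_norm.
Qed.

Lemma Linf_continuous_bounded (F : P -> 'rV[R]_n -> R) :
  compact [set: P] -> (forall p, Linf Omega (F p)) -> Linf_continuous Omega F ->
  exists c, forall p, bounded_fun (F p) c.
Proof.
move=> cP FL Fc.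
apply: (compact_uniform_bound (Q := fun c p => bounded_fun (F p) c)) => //.
  move=> c c' p cc' [mF Fb]; split=> //.
  by apply: filterS Fb => x + Ox => /(_ Ox)/le_trans; apply.
move=> p; have [_ /Linf_norm_lty_ae[c Fpc]] := FL p.
exists (c + 1); apply: filterS (cvg0_near_le1 (Fc p)) => q /Linf_norm_le_ae Fq.
split; first by have [] := FL q.
apply: filterS2 Fpc Fq => x Fpc Fq Ox; rewrite -(subrK (F p x) (F q x)) addrC.
by apply: le_trans (ler_normD _ _) _; apply: lerD; [exact: Fpc|exact: Fq].
Qed.

Lemma Linf_vec_continuous_bounded (F : P -> 'rV[R]_n -> 'rV[R]_n) :
  compact [set: P] -> (forall p, Linf_vec Omega (F p)) ->
  Linf_vec_continuous Omega F ->
  exists c, forall p j, bounded_fun (fun x => F p x 0 j) c.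
Proof.
move=> cP FL Fc.
apply: (compact_uniform_bound
  (Q := fun c p => forall j, bounded_fun (fun x => F p x 0 j) c)) => //.
  move=> c c' p cc' Fb j; have [mF {}Fb] := Fb j; split=> //.
  by apply: filterS Fb => x + Ox => /(_ Ox)/le_trans; apply.
move=> p; have [_ /Linf_norm_lty_ae[c Fpc]] := FL p.
exists (c + 1); apply: filterS (cvg0_near_le1 (Fc p)) => q /Linf_norm_le_ae Fq j.
split; first by have [] := FL q.
apply: filterS2 Fpc Fq => x /= Fpc Fq Ox.
rewrite -(subrK (F p x 0 j) (F q x 0 j)) addrC.
apply: le_trans (ler_normD _ _) _; apply: lerD.
  apply: le_trans (enorm_coord_le _ j) _.
  exact: le_trans (ler_norm _) (Fpc Ox).
have := enorm_coord_le (F q x - F p x) j; rewrite !mxE => /le_trans; apply.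
exact: le_trans (ler_norm _) (Fq Ox).
Qed.

(** An essential bound on an open set holds at every point of continuity; this
    makes point values of the diffusion accessible. *)
Lemma ae_le_pointwise (f : 'rV[R]_n -> R) c x :
  {within closure Omega, continuous f} -> Omega x ->
  {ae lebesgue_rV, forall y, Omega y -> `|f y| <= c} -> `|f x| <= c.
Proof.
move=> fc Ox fle; rewrite leNgt; apply/negP => cfx.
have {}fc : {for x, continuous f}.
  have := continuous_subspaceW (@subset_closure _ Omega) fc.
  by rewrite continuous_open_subspace// => /(_ x (mem_set Ox)).
have : \forall y \near x, Omega y /\ c < `|f y|.
  apply: filterI; first exact: open_nbhs_nbhs.
  exact: (@cvgr_gt _ _ _ _ _ _ (cvg_norm fc)).
move=> xU; have [y Uy] := ae_dense (@open_interior _ _) xU fle.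
by have [Oy cfy] := interior_subset Uy => /(_ Oy); rewrite leNgt cfy.
Qed.

Lemma Linf_continuous_pointwise_bounded (F : P -> 'rV[R]_n -> R) x :
  compact [set: P] -> (forall p, {within closure Omega, continuous (F p)}) ->
  Linf_continuous Omega F -> Omega x -> exists c, forall p, `|F p x| <= c.
Proof.
move=> cP Fx Fc Ox.
apply: (compact_uniform_bound (Q := fun c p => `|F p x| <= c)) => //.
  by move=> c c' p cc' /le_trans; apply.
move=> p; exists (`|F p x| + 1).
apply: filterS (cvg0_near_le1 (Fc p)) => q /Linf_norm_le_ae Fq.
rewrite -[X in `|X|](subrK (F p x)) addrC.
apply: le_trans (ler_normD _ _) _; rewrite lerD2l.
apply: (ae_le_pointwise (f := F q \- F p)) Fq => //.
by move=> y; apply: cvgB; [exact: Fx|exact: Fx].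
Qed.

End Linf_bounds.

Section interior_rows.
Context {R : realType} {n : nat} (Omega : set 'rV[R]_n) (M : mesh R n).
Variable phi : 'I_(nb_nodes M) -> 'rV[R]_n -> R.
Hypotheses (hM : simplicial_mesh Omega M) (hphi : hat_functions Omega phi).
Hypotheses (oO : open Omega) (bO : bounded_set Omega).
Implicit Types (w z : 'rV[R]_n -> R) (C : coefficients R n).
Notation bounded_fun := (ess_bounded (@lebesgue_rV R n) Omega).

Let mO : measurable Omega := open_measurable_rV oO.
Let muO : (lebesgue_rV Omega < +oo)%E := bounded_lebesgue_rV mO bO.

Lemma fe_grad_cell w K x p (c : R) : fe_space Omega M w -> K \in cells M ->
  (forall y, hull K y -> w y = dotv p y + c) ->
  interior (hull K) x -> fe_grad M w x = p.
Proof.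
move=> wV MK wE Kx; rewrite /fe_grad; case: asboolP => [_|[]]; last by exists K.
by apply: (grad_affine (c := c)); apply: filterS Kx => y; exact: wE.
Qed.

Lemma fe_grad_lin (a : R) w z x : fe_space Omega M w -> fe_space Omega M z ->
  fe_grad M (fun y => a * w y + z y) x = a *: fe_grad M w x + fe_grad M z x.
Proof.
move=> wV zV; have [[K MK Kx]|nK] :=
  pselect (exists2 K, K \in cells M & interior (@hull R n M K) x); last first.
  by rewrite /fe_grad; case: asboolP => // _; rewrite scaler0 addr0.
have [_ _ /(_ K MK)[p [c wE]]] := wV; have [_ _ /(_ K MK)[q [b zE]]] := zV.
rewrite (fe_grad_cell wV MK wE Kx) (fe_grad_cell zV MK zE Kx).
apply: (fe_grad_cell (c := a * c + b) _ MK _ Kx).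
  exact: fe_spaceD (fe_spaceZ a wV) zV.
by move=> y Ky; rewrite wE// zE// dotvDl dotvZl; ring.
Qed.

(** The discrete gradient takes one value [G K] inside each cell [K], and it
    vanishes off the open union [U] of the cell interiors. *)
Lemma fe_grad_bounded w j : fe_space Omega M w ->
  exists c, bounded_fun (fun x => fe_grad M w x 0 j) c.
Proof.
move=> wV.
have /choice[G GE] : forall K : {set 'I_(nb_nodes M)}, exists p : 'rV[R]_n,
    K \in cells M -> forall x, interior (hull K) x -> fe_grad M w x = p.
  move=> K; have [MK|] := boolP (K \in cells M); last by exists 0.
  have [_ _ /(_ K MK)[p [c wE]]] := wV; exists p => _ x.
  exact: fe_grad_cell wV MK wE.
pose U := \bigcup_(K in [set K | K \in cells M]) interior (@hull R n M K).
have oU : open U by apply: bigcup_open => K _; exact: open_interior.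
exists (\sum_(K : {set 'I_(nb_nodes M)}) `|G K 0 j|); split; last first.
  apply: aeW => x _; have [[K MK Kx]|nU] := pselect (U x).
    by rewrite (GE K MK x Kx) (bigD1 K)//= lerDl sumr_ge0.
  rewrite /fe_grad; case: asboolP => [[K MK Kx]|_].
    by exfalso; apply: nU; exists K.
  by rewrite mxE normr0 sumr_ge0.
have -> : (fun x => fe_grad M w x 0 j) = (fun x => fe_grad M w x 0 j) \_ U.
  apply/funext => x; rewrite /patch; case: ifPn => // /negP nU.
  rewrite /fe_grad; case: asboolP => [[K MK Kx]|_]; last by rewrite mxE.
  by exfalso; apply: nU; apply/mem_set; exists K.
apply: measurable_funTS; apply/(measurable_restrictT _ _).1.
  exact: open_measurable_rV.
apply: continuous_measurable_rV => // x /set_mem[K MK Kx].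
apply: (near_cst_continuous (G K 0 j)); near=> y.
rewrite (GE K MK y)//; near: y; apply: open_nbhs_nbhs; split=> //.
exact: open_interior.
Unshelve. all: by end_near. Qed.

(** The bound comes from the nodal expansion, as the hat functions take values in
    the unit interval. *)
Lemma fe_space_bounded w : fe_space Omega M w -> exists c, bounded_fun w c.
Proof.
move=> wV; exists (\sum_m `|w (@node R n M m)|); split.
  apply: continuous_measurable_rV => // x /set_mem Ox.
  exact: fe_space_continuous wV Ox.
apply: aeW => x Ox; rewrite (fe_space_nodal hM hphi x wV).
apply: le_trans (ler_norm_sum _ _ _) _; apply: ler_sum => m _.
have p0 := hat_ge0 hM hphi.
rewrite normrM ler_piMr// ger0_norm//.
rewrite -(sum_hat hM hphi (subset_closure Ox)) (bigD1 m)//= lerDl.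
exact: sumr_ge0.
Qed.

Lemma hat1_fe_space l : fe_space Omega M (hat1 Omega phi l).
Proof.
rewrite (_ : hat1 Omega phi l = fun x =>
  (\int[lebesgue_rV]_(y in Omega) `|phi l y|)^-1 * phi l x); last first.
  by apply/funext => x; rewrite /hat1 mulrC.
by apply: fe_spaceZ; have [] := hphi l.
Qed.

Lemma dotv_bounded (F G : 'rV[R]_n -> 'rV[R]_n) (b c : 'I_n -> R) :
  (forall j, bounded_fun (fun x => F x 0 j) (b j)) ->
  (forall j, bounded_fun (fun x => G x 0 j) (c j)) ->
  bounded_fun (fun x => dotv (F x) (G x)) (\sum_j b j * c j).
Proof. by move=> Fb Gc; apply: ess_bounded_sum => j; exact: ess_boundedM. Qed.

Lemma integral_bounded_lin (a : R) w z b c : bounded_fun w b -> bounded_fun z c ->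
  \int[lebesgue_rV]_(x in Omega) (a * w x + z x) =
  a * (\int[lebesgue_rV]_(x in Omega) w x) + \int[lebesgue_rV]_(x in Omega) z x.
Proof.
move=> wb zc.
have ab : bounded_fun (fun x => a * w x) (`|a| * b).
  exact: ess_boundedM (ess_bounded_cst _ _ a) wb.
rewrite RintegralD//; first last.
- exact: ess_bounded_integrable zc.
- exact: ess_bounded_integrable ab.
by rewrite RintegralZl//; exact: ess_bounded_integrable wb.
Qed.

Definition coefficients_bounded (b c : R) C :=
  (forall j, bounded_fun (fun x => advection C x 0 j) b) /\
  bounded_fun (reaction C) c.

Let grad_hat l (w : 'rV[R]_n -> R) x :=
  dotv (fe_grad M w x) (fe_grad M (hat1 Omega phi l) x).

Let lower_order C l (w : 'rV[R]_n -> R) x :=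
  (- dotv (advection C x) (fe_grad M w x) + reaction C x * w x) *
  hat1 Omega phi l x.

Lemma interior_rowE C w l : interior_row Omega phi C w l =
  diffusion C (node l) * (\int[lebesgue_rV]_(x in Omega) grad_hat l w x) +
  \int[lebesgue_rV]_(x in Omega) lower_order C l w x.
Proof. by []. Qed.

Lemma integrands_bounded l w b c : fe_space Omega M w ->
  exists cg cl, bounded_fun (grad_hat l w) cg /\
    forall C, coefficients_bounded b c C -> bounded_fun (lower_order C l w) cl.
Proof.
move=> wV.
have /choice[g gP] := fun j => fe_grad_bounded j wV.
have /choice[k kP] := fun j => fe_grad_bounded j (hat1_fe_space l).
have [cw wP] := fe_space_bounded wV.
have [ch hP] := fe_space_bounded (hat1_fe_space l).
exists (\sum_j g j * k j), ((\sum_j b * g j + c * cw) * ch); split.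
  exact: dotv_bounded.
move=> C [bP cP]; apply: ess_boundedM hP; apply: ess_boundedD.
  by apply: ess_boundedN; apply: (dotv_bounded (b := fun=> b)).
exact: ess_boundedM.
Qed.

Lemma interior_row_lin C b c (a : R) w z l : coefficients_bounded b c C ->
  fe_space Omega M w -> fe_space Omega M z ->
  interior_row Omega phi C (fun x => a * w x + z x) l =
  a * interior_row Omega phi C w l + interior_row Omega phi C z l.
Proof.
move=> Cbc wV zV.
have [wg [wl [wgP /(_ C Cbc) wlP]]] := integrands_bounded l b c wV.
have [zg [zl [zgP /(_ C Cbc) zlP]]] := integrands_bounded l b c zV.
have gradE : \int[lebesgue_rV]_(x in Omega) grad_hat l (fun y => a * w y + z y) x =
    a * (\int[lebesgue_rV]_(x in Omega) grad_hat l w x) +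
    \int[lebesgue_rV]_(x in Omega) grad_hat l z x.
  rewrite -(integral_bounded_lin a wgP zgP); apply: eq_Rintegral => x _.
  by rewrite /grad_hat fe_grad_lin// dotvDl dotvZl.
have lowerE :
    \int[lebesgue_rV]_(x in Omega) lower_order C l (fun y => a * w y + z y) x =
    a * (\int[lebesgue_rV]_(x in Omega) lower_order C l w x) +
    \int[lebesgue_rV]_(x in Omega) lower_order C l z x.
  rewrite -(integral_bounded_lin a wlP zlP); apply: eq_Rintegral => x _.
  by rewrite /lower_order fe_grad_lin// dotvDr dotvZr; ring.
rewrite 3!interior_rowE gradE lowerE.
have distr (k x y r s : R) : k * (a * x + y) + (a * r + s) =
    a * (k * x + r) + (k * y + s) by ring.
exact: distr.
Qed.

Lemma interior_row_sum C b c (I : Type) (s : seq I) (a : I -> R)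
    (w : I -> 'rV[R]_n -> R) l :
  coefficients_bounded b c C -> (forall i, fe_space Omega M (w i)) ->
  interior_row Omega phi C (fun x => \sum_(i <- s) a i * w i x) l =
  \sum_(i <- s) a i * interior_row Omega phi C (w i) l.
Proof.
move=> Cbc wV; elim: s => [|i s IH].
  under [X in interior_row _ _ _ X _]eq_fun do rewrite big_nil.
  have V0 : fe_space Omega M (fun=> 0) := fe_space0_in Omega M.
  have := interior_row_lin (- 1) l Cbc V0 V0.
  rewrite mulr0 addr0 big_nil mulN1r => ->; exact: addNr.
under [X in interior_row _ _ _ X _]eq_fun do rewrite big_cons.
by rewrite (interior_row_lin _ _ Cbc)// ?big_cons ?IH//; exact: fe_space_sum.
Qed.

(** The bound depends on [C] only through the bounds on the coefficients, hence
    it is uniform over a family of controls. *)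
Lemma interior_row_bounded (a b c : R) l w : fe_space Omega M w ->
  exists L, forall C, coefficients_bounded b c C -> `|diffusion C (node l)| <= a ->
    `|interior_row Omega phi C w l| <= L.
Proof.
move=> wV; have [cg [cl [gP lP]]] := integrands_bounded l b c wV.
exists (a * `|inner_vec Omega (fe_grad M w) (fe_grad M (hat1 Omega phi l))|
  + `|cl| * fine (lebesgue_rV Omega)) => C Cbc Ca.
apply: le_trans (ler_normD _ _) _; rewrite normrM; apply: lerD.
  by rewrite ler_wpM2r.
apply: ess_bounded_integral => //.
have [ml bl] := lP C Cbc; split=> //.
by apply: filterS bl => x + Ox => /(_ Ox)/le_trans; apply; exact: ler_norm.
Qed.

End interior_rows.

(** * The scheme *)

Lemma finite_uniform_bound (R : realType) (I : finType) (P : Type)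
    (F : I -> P -> R) :
  (forall i, exists L, forall p, `|F i p| <= L) ->
  exists2 L, 0 <= L & forall i p, `|F i p| <= L.
Proof.
move=> /choice[L FL]; exists (\sum_i `|L i|); first exact: sumr_ge0.
move=> i p; rewrite (bigD1 i)//= -[leLHS]addr0 lerD ?sumr_ge0//.
exact: le_trans (FL i p) (ler_norm _).
Qed.

Section time_step.
Context {R : realType} {n : nat} (Omega : set 'rV[R]_n) (M : mesh R n).
Context {A B : topologicalType}.
Variable phi : 'I_(nb_nodes M) -> 'rV[R]_n -> R.
Variables (N : nat) (CE CI : A * B -> coefficients R n).
Variables (f : A * B -> 'rV[R]_n -> R) (Pg : 'rV[R]_n -> R) (h : R).
Hypothesis hOmega : bounded_lipschitz_domain Omega.
Hypotheses (hM : simplicial_mesh Omega M) (hphi : hat_functions Omega phi).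
Hypothesis hN : forall l : 'I_(nb_nodes M), Omega (node l) <-> (l < N)%N.
Hypotheses (hA : compact [set: A]) (hB : compact [set: B]).
Variables (a0 : A) (b0 : B).
Hypotheses (hCE : coefficient_family Omega CE) (hCI : coefficient_family Omega CI).
Hypotheses (hf : forall p, Linf Omega (f p)) (hfc : Linf_continuous Omega f).
Hypothesis hI : forall p, local_monotonicity Omega (implicit_op Omega phi N (CI p)).
Hypotheses (h_gt0 : 0 < h) (hPg : fe_space Omega M Pg).
Implicit Types (u w : 'rV[R]_n -> R) (l m : 'I_(nb_nodes M)).

Let oO : open Omega. Proof. by case: hOmega. Qed.
Let bO : bounded_set Omega. Proof. by case: hOmega. Qed.
Let cAB : compact [set: A * B].
Proof. by rewrite -setXTT; exact: compact_setX. Qed.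

Lemma family_bounded C : coefficient_family Omega C ->
  exists b c, forall p : A * B, coefficients_bounded Omega b c (C p).
Proof.
move=> [CP _ bc cc].
have [b bP] := Linf_vec_continuous_bounded cAB
  (fun p => let: And4 _ H _ _ := CP p in H) bc.
have [c cP] := Linf_continuous_bounded cAB
  (fun p => let: And4 _ _ H _ := CP p in H) cc.
by exists b, c => p; split.
Qed.

Lemma family_interior_row_bounded C w l : coefficient_family Omega C ->
  fe_space Omega M w -> Omega (node l) ->
  exists L, forall p : A * B, `|interior_row Omega phi (C p) w l| <= L.
Proof.
move=> hC wV Ol; have [b [c Cbc]] := family_bounded hC.
have [CP ac _ _] := hC.
have [a aP] := Linf_continuous_pointwise_bounded oO cAB
  (fun p => let: And4 H _ _ _ := CP p in H) ac Ol.
have [L LP] := interior_row_bounded hM hphi oO bO a b c l wV.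
by exists L => p; apply: LP.
Qed.

Lemma explicit_op_bounded w l : fe_space Omega M w ->
  exists L, forall p, `|explicit_op Omega phi N (CE p) w l| <= L.
Proof.
move=> wV; rewrite /explicit_op; case: (boolP (l < N)%N) => [/hN Ol|_].
  exact: family_interior_row_bounded.
by exists 0 => p; rewrite normr0.
Qed.

Lemma implicit_op_bounded w l : fe_space Omega M w ->
  exists L, forall p, `|implicit_op Omega phi N (CI p) w l| <= L.
Proof.
move=> wV; rewrite /implicit_op; case: (boolP (l < N)%N) => [/hN Ol|_].
  exact: family_interior_row_bounded.
by exists `|w (node l)|.
Qed.

Lemma source_bounded l : exists L, forall p, `|source Omega phi N (f p) Pg l| <= L.
Proof.
rewrite /source; case: (boolP (l < N)%N) => [_|_]; last by exists `|Pg (node l)|.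
have [cf fP] := Linf_continuous_bounded cAB hf hfc.
have [ch hP] := fe_space_bounded hM hphi oO (hat1_fe_space hphi l).
exists (`|cf * ch| * fine (lebesgue_rV Omega)) => p.
have mO := open_measurable_rV oO.
apply: ess_bounded_integral => //; first exact: bounded_lebesgue_rV.
have [mfh fhb] := ess_boundedM (fP p) hP; split=> //.
by apply: filterS fhb => x + Ox => /(_ Ox)/le_trans; apply; exact: ler_norm.
Qed.

Lemma implicit_op_nodal w l p : fe_space Omega M w ->
  implicit_op Omega phi N (CI p) w l =
  \sum_m implicit_op Omega phi N (CI p) (phi m) l * w (node m).
Proof.
move=> wV; have [b [c Cbc]] := family_bounded hCI.
have phiV m : fe_space Omega M (phi m) by have [] := hphi m.
rewrite {1}(_ : w = fun x => \sum_m w (node m) * phi m x); last first.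
  by apply/funext => x; exact: (fe_space_nodal hM hphi x wV).
rewrite /implicit_op; case: (boolP (l < N)%N) => _.
  rewrite (interior_row_sum hM hphi oO bO _ _ _ (Cbc p))//.
  by apply: eq_bigr => m _; rewrite mulrC.
by apply: eq_bigr => m _; rewrite mulrC.
Qed.

(** The hat function of another node is non-negative and vanishes at node [l], so
    it has a local minimum of value zero there. *)
Lemma implicit_op_offdiag p l m : l != m ->
  implicit_op Omega phi N (CI p) (phi m) l <= 0.
Proof.
move=> lm; have [phiV phiE] := hphi m.
have phil : phi m (node l) = 0 by rewrite phiE eq_sym (negbTE lm).
have [Ol|Ol] := pselect (Omega (node l)).
  apply: hI => //; first by rewrite phil.
  apply: (@filterS _ _ (nbhs_filter _) _ _ _ (open_nbhs_nbhs (conj oO Ol))) => x _.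
  by rewrite phil; exact: (hat_ge0 hM hphi).
by rewrite /implicit_op; case: (boolP (l < N)%N) => [/hN//|_]; rewrite phil.
Qed.

(** Minus the sum of the hat functions is the constant [-1] on the closure of the
    domain, so it has a non-positive local minimum at every interior node. *)
Lemma implicit_op_rowsum p l :
  0 <= \sum_m implicit_op Omega phi N (CI p) (phi m) l.
Proof.
pose v : 'rV[R]_n -> R := fun x => \sum_m (- 1) * phi m x.
have vV : fe_space Omega M v by apply: fe_space_sum => m; have [] := hphi m.
have v1 x : closure Omega x -> v x = - 1.
  by move=> Ox; rewrite /v -mulr_sumr (sum_hat hM hphi Ox) mulr1.
have -> : \sum_m implicit_op Omega phi N (CI p) (phi m) l =
    - implicit_op Omega phi N (CI p) v l.
  rewrite implicit_op_nodal// -sumrN; apply: eq_bigr => m _.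
  by rewrite v1 ?mulrN1 ?opprK//; exact: (closure_node hM).
rewrite oppr_ge0; have [Ol|Ol] := pselect (Omega (node l)); last first.
  rewrite /implicit_op; case: (boolP (l < N)%N) => [/hN//|_].
  by rewrite v1 ?lerN10//; exact: (closure_node hM).
have vl : v (node l) = - 1 by apply: v1; exact: (closure_node hM).
apply: hI => //; rewrite vl ?lerN10//.
apply: (@filterS _ _ (nbhs_filter _) _ _ _ (open_nbhs_nbhs (conj oO Ol))) => x Ox.
by rewrite v1//; exact: subset_closure.
Qed.

Definition solves_step u w := fe_space_trace Omega M Pg w /\
  forall l, - ((u (node l) - w (node l)) / h) + infsup (fun p =>
    explicit_op Omega phi N (CE p) u l + implicit_op Omega phi N (CI p) w l -
    source Omega phi N (f p) Pg l) = 0.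

(** At a boundary node the equation reads [(1 / h + 1) (w - Pg) = 0], because
    [u] already carries the boundary datum. *)
Lemma solves_step_bdry u w : fe_space_trace Omega M Pg u ->
  fe_space Omega M w -> forall l, ~ Omega (node l) ->
  - ((u (node l) - w (node l)) / h) + infsup (fun p =>
    explicit_op Omega phi N (CE p) u l + implicit_op Omega phi N (CI p) w l -
    source Omega phi N (f p) Pg l) = 0 -> w (node l) = Pg (node l).
Proof.
move=> [uV ub] wV l Ol; rewrite ub; last exact: (bdry_node hM).
rewrite /explicit_op /implicit_op /source; case: (boolP (l < N)%N) => [/hN//|_].
rewrite add0r infsup_cst// => eq0.
have : (w (node l) - Pg (node l)) * (h^-1 + 1) = 0 by rewrite -[RHS]eq0; ring.
move/eqP; rewrite mulf_eq0 subr_eq0 => /orP[/eqP//|].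
by rewrite gt_eqF// addr_gt0// invr_gt0.
Qed.

(** Boundary nodes are rows of the system like the others, so that the boundary
    values come out of the equation and are not imposed on the fixed point. *)
Lemma step_unique_solution u : fe_space_trace Omega M Pg u ->
  exists! w, solves_step u w.
Proof.
move=> uP; have [uV ub] := uP.
have phiV m : fe_space Omega M (phi m) by have [] := hphi m.
pose a p l m := implicit_op Omega phi N (CI p) (phi m) l.
pose q p l := explicit_op Omega phi N (CE p) u l - source Omega phi N (f p) Pg l.
have [La La0 aL] := finite_uniform_bound
  (fun lm : 'I_(nb_nodes M) * 'I_(nb_nodes M) => implicit_op_bounded lm.1 (phiV lm.2)).
have [Lq Lq0 qL] : exists2 L, 0 <= L & forall l p, `|q p l| <= L.
  apply: (finite_uniform_bound (F := fun l p => q p l)) => l.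
  have [L1 L1P] := explicit_op_bounded l uV; have [L2 L2P] := source_bounded l.
  by exists (L1 + L2) => p; rewrite (le_trans (ler_normB _ _))// lerD.
have [||||||c [cP cU]] := @implicit_step_unique_solution R A B a0 b0 _ a q
  (\row_l u (node l)) h (Num.max La Lq).
- by [].
- by rewrite le_max La0.
- by move=> p l m lm; exact: implicit_op_offdiag.
- by move=> p l; exact: implicit_op_rowsum.
- by move=> p l m; rewrite le_max (aL (l, m) p).
- by move=> p l; rewrite le_max qL orbT.
have rowE w l p : fe_space Omega M w ->
    q p l + \sum_m a p l m * (\row_j w (node j)) 0 m =
    explicit_op Omega phi N (CE p) u l + implicit_op Omega phi N (CI p) w l -
    source Omega phi N (f p) Pg l.
  move=> wV; rewrite (implicit_op_nodal l p wV) /q addrAC; congr (_ + _ - _).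
  by apply: eq_bigr => m _; rewrite mxE.
pose w x := \sum_m c 0 m * phi m x.
have wV : fe_space Omega M w by exact: fe_space_sum.
have wc l : w (node l) = c 0 l.
  rewrite /w (bigD1 l)//= (hphi l).2 eqxx mulr1 big1 ?addr0// => m /negbTE ml.
  by rewrite (hphi m).2 ml mulr0.
have cE : c = \row_j w (node j) by apply/rowP => j; rewrite mxE wc.
have wS l : - ((u (node l) - w (node l)) / h) + infsup (fun p =>
    explicit_op Omega phi N (CE p) u l + implicit_op Omega phi N (CI p) w l -
    source Omega phi N (f p) Pg l) = 0.
  have := cP l; rewrite {1}cE !mxE => cl; rewrite -[RHS]cl; congr (_ + infsup _).
  by apply/funext => p; rewrite -rowE// -cE.
exists w; split.
  split=> //; apply: (fe_space_trace_nodal hM hphi hOmega hPg wV) => l Ol.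
  exact: solves_step_bdry uP wV l Ol (wS l).
move=> z [[zV _] zS]; apply/funext => x.
rewrite (fe_space_nodal hM hphi x wV) (fe_space_nodal hM hphi x zV).
suff cz : c = \row_j z (node j).
  by apply: eq_bigr => m _; rewrite wc cz mxE.
apply: cU => l; rewrite !mxE -[RHS](zS l); congr (_ + infsup _).
by apply/funext => p; rewrite -rowE.
Qed.

Lemma numerical_solutionP (PvT : 'rV[R]_n -> R) K (v : 'I_K.+1 -> 'rV[R]_n -> R) :
  numerical_solution Omega phi N CE CI f Pg PvT h v <->
  [/\ v ord_max = PvT, fe_space_trace Omega M Pg PvT &
    forall k : 'I_K, solves_step (v (lift ord0 k)) (v (widen_ord (leqnSn K) k))].
Proof.
split=> [[vV vT vS]|[vT PV vS]].
  split=> [//||k]; first by rewrite -vT.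
  by split=> [|l]; [exact: vV|exact: vS].
split=> [k|//|k l]; last by have [_ /(_ l)] := vS k.
case: (unliftP ord_max k) => [j ->|->]; last by rewrite vT.
have -> : lift ord_max j = widen_ord (leqnSn K) j.
  by apply/val_inj; rewrite /= /bump leqNgt ltn_ord.
by have [] := vS j.
Qed.

Lemma scheme_unique_solution (PvT : 'rV[R]_n -> R) K :
  fe_space_trace Omega M Pg PvT ->
  exists! v : 'I_K.+1 -> 'rV[R]_n -> R,
    numerical_solution Omega phi N CE CI f Pg PvT h v.
Proof.
move=> PV.
have /choice[F FP] : forall u, exists w, fe_space_trace Omega M Pg u ->
    solves_step u w /\ forall z, solves_step u z -> w = z.
  move=> u; have [uV|uV] := pselect (fe_space_trace Omega M Pg u).
    by have [w [wS wU]] := step_unique_solution uV; exists w.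
  by exists u.
(* Time runs backwards: level [k] is reached after [K - k] steps. *)
pose v (k : 'I_K.+1) := iter (K - k) F PvT.
have FV j : fe_space_trace Omega M Pg (iter j F PvT).
  by elim: j => [//|j IH] /=; have [[]] := FP _ IH.
have vS (k : 'I_K) : v (widen_ord (leqnSn K) k) = F (v (lift ord0 k)).
  by rewrite /v/= /bump/= add1n -iterS subnSK.
exists v; split.
  apply/numerical_solutionP; split=> //; first by rewrite /v/= subnn.
  by move=> k; rewrite vS; have [] := FP _ (FV (K - lift ord0 k)%N).
move=> z /numerical_solutionP[zT _ zS]; apply/funext => k.
have [j jk] : exists j, (j + k)%N = K by exists (K - k)%N; rewrite subnK// -ltnS.
elim: j k jk => [|j IH] k jk.
  have -> : k = ord_max by exact/val_inj.
  by rewrite zT /v/= subnn.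
have kK : (k < K)%N by rewrite (leq_trans _ (eq_leq jk))// addSn ltnS leq_addl.
have -> : k = widen_ord (leqnSn K) (Ordinal kK) by exact/val_inj.
have vz : v (lift ord0 (Ordinal kK)) = z (lift ord0 (Ordinal kK)).
  by apply: IH; rewrite /= /bump/= add1n addnS -addSn.
have [_ FU] := FP _ (FV (K - lift ord0 (Ordinal kK))%N).
rewrite vS; apply: FU; rewrite -/(v _) vz; exact: zS.
Qed.

End time_step.

Theorem theorem5p1 (R : realType) (d : nat) (Omega : set 'rV[R]_d) (T : R)
    (A B : metricType R) (vT g : 'rV[R]_d -> R)
    (M : nat -> mesh R d)
    (phi : forall i, 'I_(nb_nodes (M i)) -> 'rV[R]_d -> R)
    (N : nat -> nat) (h : nat -> R) (K : nat -> nat)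
    (D : set ('rV[R]_d -> R))
    (P : nat -> ('rV[R]_d -> R) -> ('rV[R]_d -> R))
    (CE CI : nat -> A * B -> coefficients R d)
    (f : nat -> A * B -> 'rV[R]_d -> R) (gamma : R)
    (hd : (2 <= d)%N)
    (hOmega : bounded_lipschitz_domain Omega)
    (hT : 0 < T)
    (hA : compact [set: A]) (hA0 : [set: A] !=set0)
    (hB : compact [set: B]) (hB0 : [set: B] !=set0)
    (hvT : {within closure Omega, continuous vT})
    (hg : W1inf g)
    (hlg : exists2 lg, Linf Omega lg & weak_laplacian Omega g lg)
    (hvTg : forall x, bdry Omega x -> vT x = g x)
    (hM : forall i, simplicial_mesh Omega (M i))
    (hMreg : exists sigma : R, forall i, shape_regular (M i) sigma)
    (hphi : forall i, hat_functions Omega (phi i))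
    (hdim : forall i, has_dim (fe_space0 Omega (M i)) (N i))
    (hN : forall i (l : 'I_(nb_nodes (M i))), Omega (node l) <-> (l < N i)%N)
    (hh : forall i, 0 < h i)
    (hhT : forall i, T / h i = (K i)%:R)
    (hDg : D g) (hDvT : D vT)
    (hD : forall (a : R) u w, D u -> D w -> D (fun x => a * u x + w x))
    (hPV : forall i u, D u -> fe_space Omega (M i) (P i u))
    (hPlin : forall i (a : R) u w, D u -> D w ->
      P i (fun x => a * u x + w x) = (fun x => a * P i u x + P i w x))
    (hPbd : forall i x, bdry Omega x -> P i vT x = P i g x)
    (hCE : forall i, coefficient_family Omega (CE i))
    (hCI : forall i, coefficient_family Omega (CI i))
    (hf : forall i p, Linf Omega (f i p))
    (hfc : forall i, Linf_continuous Omega (f i))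
    (hgamma : forall i p, (Linf_norm Omega (reaction (CE i p)) +
      Linf_norm Omega (reaction (CI i p)) <= gamma%:E)%E)
    (hEoff : forall i p (l m : 'I_(nb_nodes (M i))), l != m ->
      explicit_op Omega (phi i) (N i) (CE i p) (phi i m) l <= 0)
    (hEh : forall i p (l m : 'I_(nb_nodes (M i))),
      h i * explicit_op Omega (phi i) (N i) (CE i p) (phi i m) l
        - (l == m)%:R <= 0)
    (hI : forall i p, local_monotonicity Omega
      (implicit_op Omega (phi i) (N i) (CI i p))) :
  forall i, exists! v : 'I_(K i).+1 -> 'rV[R]_d -> R,
    numerical_solution Omega (phi i) (N i) (CE i) (CI i) (f i)
      (P i g) (P i vT) (h i) v.
Proof.
have [[a0 _] [b0 _]] := (hA0, hB0).
move=> i; apply: (scheme_unique_solution (A := A) (B := B) hOmega (hM i) (hphi i) (hN i)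
  hA hB a0 b0) => //.
- exact: hPV.
- by split; [exact: hPV|exact: hPbd].
Qed.
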